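(* Let $z_0\in V=(0,1)^2$ and $R>0$ with $\overline{B_R(z_0)}\subset V$. For a sequence $\eta\to0$ of positive numbers and radii $0<r_\eta\le R^2$, let $\Sigma_Y^\eta=T_{r_\eta}:=(0,1)\times B_{r_\eta}(z_0)$. Assume $$\eta\,|\ln(r_\eta)|\to\infty .$$ Then $\Sigma_Y^\eta$ is asymptotically disconnected in the direction $e_1$, i.e. there exists a sequence $\Phi_\eta\in\dot H_\#(\operatorname{curl},Z)$ with $$\eta^{1/2}\|\Phi_\eta-e_1\|_{L^2(Z)}\to0,\qquad\Phi_\eta|_{\Sigma_Y^\eta}=0,\qquad\eta^{-1/2}\|\operatorname{curl}\Phi_\eta\|_{L^2(Z)}\to0 .$$
   Context: $B_r(z_0)\subset\mathbb{R}^2$ is the disc of radius $r$ around $z_0$, placed in the coordinates $(x_2,x_3)$, so that $T_{r}=\{x\in\mathbb{R}^3:x_1\in(0,1),\ (x_2,x_3)\in B_r(z_0)\}$. $Z=(0,1)^2\times\mathbb{R}$. $H_{\mathrm{loc}}(\operatorname{curl},\mathbb{R}^3)$ is the set of $u\in L^2_{\mathrm{loc}}(\mathbb{R}^3,\mathbb{C}^3)$ with distributional curl in $L^2_{\mathrm{loc}}(\mathbb{R}^3,\mathbb{C}^3)$, and $\dot H_\#(\operatorname{curl},Z)$ is the set of restrictions $u|_Z$ of functions $u\in H_{\mathrm{loc}}(\operatorname{curl},\mathbb{R}^3)$ that are $1$-periodic in the directions $e_1$ and $e_2$. Limits are along the sequence $\eta\to0$; vanishing on a set is understood almost everywhere.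 *)

(* Defs.v *)
From HB Require Import structures.
From mathcomp Require Import all_boot all_order all_algebra.
From mathcomp Require Import complex.
From mathcomp Require Import all_classical all_reals all_analysis.
Set Implicit Arguments.
Unset Strict Implicit.
Unset Printing Implicit Defensive.
Import Order.TTheory GRing.Theory Num.Theory.
Import numFieldNormedType.Exports.
Local Open Scope classical_set_scope.
Local Open Scope ring_scope.
Local Open Scope complex_scope.

(* Coordinates and directions are indexed by 'I_3, starting from 0: the indices
   0, 1, 2 stand for the directions e_1, e_2, e_3. *)

Notation point3 R := (R * R * R)%type.
(* Same underlying type, with the sigma-algebra carried by Lebesgue measure. *)
Notation mpoint3 R :=
  (measurableTypeR R * measurableTypeR R * measurableTypeR R)%type.
Notation cfield3 R := (point3 R -> 'rV[R[i]]_3).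

Definition basis3 (R : realType) (k : 'I_3) : point3 R :=
  ((k == 0)%:R, (k == 1)%:R, (k == 2)%:R).

Definition leb3 (R : realType) :
    {measure set (mpoint3 R) -> \bar R} :=
  ((@lebesgue_measure R \x @lebesgue_measure R) \x @lebesgue_measure R)%E.

Definition vnorm (R : realType) (v : 'rV[R[i]]_3) : R :=
  Num.sqrt (\sum_(k < 3) (complex.Re (v 0 k) ^+ 2 + complex.Im (v 0 k) ^+ 2)).

Definition L2norm (R : realType) (D : set (point3 R)) (u : cfield3 R) : \bar R :=
  ('N[leb3 R]_2[(fun x => (vnorm (u x))%:E) \_ D])%E.

Definition measurable_field (R : realType) (D : set (point3 R)) (u : cfield3 R) :=
  forall k : 'I_3,
    measurable_fun D (fun x : mpoint3 R => complex.Re (u x 0 k)) /\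
    measurable_fun D (fun x : mpoint3 R => complex.Im (u x 0 k)).

Definition L2loc (R : realType) (Om : set (point3 R)) : set (cfield3 R) :=
  [set u | measurable_field Om u /\
    forall K : set (point3 R), compact K -> K `<=` Om -> (L2norm K u < +oo)%E].

(* All iterated partial derivatives exist and are continuous. *)
Definition smooth (R : realType) (f : point3 R -> R) :=
  forall s : seq 'I_3,
    let g := foldr (fun k h => 'D_(basis3 R k) h) f s in
    continuous g /\ forall k x, derivable g x (basis3 R k).

Definition support_in (R : realType) (Om : set (point3 R)) (f : point3 R -> R) :=
  let K := closure [set x | f x != 0] in compact K /\ K `<=` Om.

Definition test_field (R : realType) (Om : set (point3 R))
    (phi : point3 R -> 'rV[R]_3) :=
  forall k : 'I_3, smooth (fun x => phi x 0 k) /\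
                   support_in Om (fun x => phi x 0 k).

(* Indices are taken modulo 3 in the ring 'I_3. *)
Definition curl (R : realType) (phi : point3 R -> 'rV[R]_3) (x : point3 R)
    : 'rV[R]_3 :=
  \row_(k < 3) ('D_(basis3 R (k + 1)) (fun y => phi y 0 (k + 2)) x
              - 'D_(basis3 R (k + 2)) (fun y => phi y 0 (k + 1)) x).

Definition cintegral (R : realType) (D : set (point3 R)) (f : point3 R -> R[i])
    : R[i] :=
  (\int[leb3 R]_(x in D) complex.Re (f x))%R +i*
  (\int[leb3 R]_(x in D) complex.Im (f x))%R.

Definition dotmul (R : realType) (v : 'rV[R[i]]_3) (a : 'rV[R]_3) : R[i] :=
  \sum_(k < 3) v 0 k * (a 0 k)%:C.

(* w is the distributional curl of u on the open set Om. Testing with real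
   fields is enough, by linearity. *)
Definition is_curl (R : realType) (Om : set (point3 R)) (u w : cfield3 R) :=
  forall phi, test_field Om phi ->
    cintegral Om (fun x => dotmul (w x) (phi x)) =
    cintegral Om (fun x => dotmul (u x) (curl phi x)).

Definition Hloc_curl (R : realType) : set (cfield3 R) :=
  [set u | L2loc setT u /\ exists2 w, L2loc setT w & is_curl setT u w].

Definition ae_periodic (R : realType) (k : 'I_3) (u : cfield3 R) :=
  {ae leb3 R, forall x : point3 R, u (x + basis3 R k) = u x}.

Definition Zset (R : realType) : set (point3 R) :=
  [set x | 0 < x.1.1 < 1 /\ 0 < x.1.2 < 1].

(* The restriction u|_Z is represented by any function that agrees with u
   on Z; its values outside Z are irrelevant. *)
Definition Hdot_per_curl (R : realType) : set (cfield3 R) :=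
  [set Phi | exists u, [/\ Hloc_curl u, ae_periodic 0 u, ae_periodic 1 u &
                          forall x, Zset x -> Phi x = u x]].

Definition cbasis3 (R : realType) (k : 'I_3) : 'rV[R[i]]_3 := delta_mx 0 k.

Definition asymptotically_disconnected (R : realType) (eta : nat -> R)
    (Sigma : nat -> set (point3 R)) (k : 'I_3) :=
  exists Phi W : nat -> cfield3 R,
    [/\ forall n, Hdot_per_curl (Phi n),
        forall n, L2loc (@Zset R) (W n) /\ is_curl (@Zset R) (Phi n) (W n),
        (fun n => (Num.sqrt (eta n))%:E *
           L2norm (@Zset R) (fun x => Phi n x - cbasis3 R k)%R)%E @ \oo --> 0%E,
        forall n, {ae leb3 R, forall x, Sigma n x -> Phi n x = 0} &
        (fun n => ((Num.sqrt (eta n))^-1)%:E * L2norm (@Zset R) (W n))%E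
          @ \oo --> 0%E].

(* Euclidean disc; the canonical ball of R * R is that of the maximum norm. *)
Definition disc (R : realType) (z : R * R) (r : R) : set (R * R) :=
  [set y | (y.1 - z.1) ^+ 2 + (y.2 - z.2) ^+ 2 < r ^+ 2].

Definition unit_square (R : realType) : set (R * R) :=
  [set y | 0 < y.1 < 1 /\ 0 < y.2 < 1].

(* The disc lies in the (x_2, x_3)-plane. *)
Definition tube (R : realType) (z : R * R) (r : R) : set (point3 R) :=
  [set x | 0 < x.1.1 < 1 /\ disc z r (x.1.2, x.2)].

(* Main.v *)
From HB Require Import structures.
Require Import Defs.
From mathcomp Require Import all_boot all_order all_algebra.
From mathcomp Require Import complex.
From mathcomp Require Import all_classical all_reals all_analysis.
From mathcomp Require Import measurable_realfun ring lra.
Set Implicit Arguments.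
Unset Strict Implicit.
Unset Printing Implicit Defensive.
Import Order.TTheory GRing.Theory Num.Theory.
Import numFieldNormedType.Exports.
Local Open Scope classical_set_scope.
Local Open Scope ring_scope.

(** The plane has zero logarithmic capacity at a point: among functions of
    (x_2, x_3) that vanish on a disc of radius r and equal 1 at distance of order
    one, the least Dirichlet energy is of order 1 / |ln r|.  Take such a function
    phi and put Phi = phi e_1.  Since phi does not depend on x_1, the curl of Phi
    is (0, d_3 phi, - d_2 phi), so that the square of its norm on Z is the energy
    of phi, of order 1 / |ln r|; divided by eta it tends to 0 because
    eta |ln r| tends to infinity.  On the other hand Phi - e_1 is bounded by 1 and
    supported in a bounded part of Z that is the same for all r, so its norm
    multiplied by the square root of eta tends to 0 with eta.

    A cut-off that is given by one C^1 formula on the whole space, and is already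
    periodic, avoids gluing copies along the faces of Z.  With z_0 = (a, b), the
    gauge q = sin(pi (x_2 - a))^2 + (pi (x_3 - b))^2 is comparable to the square
    of the distance to the periodic copies of z_0.  With d = (pi r)^2 and
    L = - ln r, the potential is

      phi = cutoff ((ln (q + d) - ln (2 d)) / L),

    where cutoff is C^1, vanishes on the negative reals and is 1 beyond 1.  It
    vanishes where q <= d, hence on the tube, because |sin y| <= |y|, and it is 1
    as soon as |x_3 - b| > 2.

    - Energy.  The chain rule gives |grad phi|^2 <= (16 pi^2 / L^2) / (q + d)
      (profile_grad_bound).  The integral of 1 / (q + d) over the part of
      Z where |x_3 - b| <= 2 is at most 6 (ln 5 + L) (integral_inv_gauge_le): the
      primitive is an arctangent in x_3 and then, after comparing the sine with
      the distance to its nearest zero, an inverse hyperbolic sine in x_2.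

    - Distributional curl.  As phi is C^1, its classical curl is its
      distributional curl (is_curl_axial).  This amounts to the vanishing of the
      integral of d_k (phi g) for g smooth with compact support
      (integral_derive_mul_eq0), that is to the fundamental theorem of calculus on
      lines and Fubini's theorem.

    Finally, a disc that fits in the unit square has rho < 1, so |ln r| is bounded
    below by |ln rho^2| > 0 and (ln 5 + L) / L^2 is at most a constant times
    1 / L. *)

(** * Borel sets and integrability in dimension three *)

(** The product sigma-algebra is generated by boxes; it contains the open sets
    because these are countable unions of cubes with rational centre and side. *)
Lemma open_measurable3 (R : realType) (U : set (point3 R)) :
  open U -> measurable (U : set (mpoint3 R)).
Proof.
move=> oU.
pose B (p : rat * rat * rat * rat) : set (mpoint3 R) :=
  (ball (ratr p.1.1.1 : R) (ratr p.2) `*` ball (ratr p.1.1.2 : R) (ratr p.2))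
  `*` ball (ratr p.1.2 : R) (ratr p.2).
pose F p : set (mpoint3 R) := if `[< B p `<=` U >] then B p else set0.
have -> : U = \bigcup_p F p.
  apply/seteqP; split=> [x Ux|x [p _]]; last first.
    by rewrite /F; case: asboolP => // BU; exact: BU.
  have /nbhs_ballP[e /= e0 xeU] : nbhs x U by exact: open_nbhs_nbhs.
  (* Two points of a cube of half-side s are within 2 s < e of each other. *)
  have [s] := @rat_in_itvoo R 0 (e / 2) ltac:(lra).
  rewrite in_itv/= => /andP[s0 se].
  have cE (t : R) : exists c : rat, ball (ratr c : R) (ratr s) t.
    have [c] := @rat_in_itvoo R (t - ratr s) t ltac:(lra).
    rewrite in_itv/= => /andP[c1 c2]; exists c.
    by rewrite /ball/= ltr_norml; apply/andP; split; lra.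
  have [c1 b1] := cE x.1.1; have [c2 b2] := cE x.1.2; have [c3 b3] := cE x.2.
  exists (c1, c2, c3, s) => //; rewrite /F; case: asboolP; first by [].
  case=> y [[/= y1 y2] y3]; apply: xeU.
  have close (a b c : R) : ball (c : R) (ratr s) a -> ball (c : R) (ratr s) b ->
      ball (a : R) e b.
    by rewrite /ball/= !ltr_norml => /andP[? ?] /andP[? ?]; apply/andP; split; lra.
  by split; [split|]; [exact: close y1|exact: close y2|exact: close y3].
apply: countable_bigcupT_measurable; first exact: countableP.
move=> p; rewrite /F; case: asboolP => // _.
by apply: measurableX; [apply: measurableX|]; rewrite ball_itv; exact: measurable_itv.
Qed.

Lemma continuous_measurable3 (R : realType) (f : point3 R -> R) :
  continuous f -> measurable_fun setT (f : mpoint3 R -> measurableTypeR R).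
Proof.
move=> cf; apply: (measurability _ (RGenOpens.measurableE R)) => _ [_ [a [b ->] <-]].
by rewrite setTI; apply: open_measurable3; apply: open_comp => //; exact: interval_open.
Qed.

(** Used for fields on the space and for their slices by planes alike. *)
Lemma integrable_bounded_supp d (T : measurableType d) (R : realType)
    (mu : {measure set T -> \bar R}) (D : set T) (C : R) (f : T -> R) :
  measurable D -> (mu D < +oo)%E -> measurable_fun setT f ->
  (forall x, `|f x| <= C) -> (forall x, ~ D x -> f x = 0) ->
  mu.-integrable setT (EFin \o f).
Proof.
move=> mD muD mf fC f0.
have -> : EFin \o f = (EFin \o f) \_ D.
  apply/funext => x; rewrite patchE; case: ifPn => //; rewrite notin_setE => Dx.
  by rewrite /= f0.
apply: (integrable_mkcond _ mD).1; apply: measurable_bounded_integrable => //.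
  exact: measurable_funTS.
by exists C; split; [exact: num_real|move=> M CM x _; exact: le_trans (ltW CM)].
Qed.

Definition seg (R : realType) (M : R) : set (measurableTypeR R) := [set` `[- M, M]].
Definition box2 (R : realType) (M : R) := seg M `*` seg M.
Definition box3 (R : realType) (M : R) := box2 M `*` seg M.

Lemma measurable_seg (R : realType) (M : R) : measurable (seg M).
Proof. exact: measurable_itv. Qed.

Lemma measurable_box3 (R : realType) (M : R) : measurable (box3 M).
Proof. by apply: measurableX; [apply: measurableX|]; exact: measurable_seg. Qed.

Lemma seg_lty (R : realType) (M : R) : (@lebesgue_measure R (seg M) < +oo)%E.
Proof.
rewrite /seg lebesgue_measure_itv/=; case: ifPn => // _.
by rewrite -EFinB ltry.
Qed.

Lemma box2_lty (R : realType) (M : R) :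
  ((@lebesgue_measure R \x @lebesgue_measure R) (box2 M) < +oo)%E.
Proof.
rewrite product_measure1E; try exact: measurable_seg.
by apply: lte_mul_pinfty; rewrite ?ge0_fin_numE ?seg_lty.
Qed.

Lemma box3_lty (R : realType) (M : R) : (leb3 R (box3 M) < +oo)%E.
Proof.
rewrite /box3 [leb3 R _](@product_measure1E _ _ _ _ _ (lebesgue_measure \x lebesgue_measure)%E (@lebesgue_measure R)); last 2 first.
- by apply: measurableX; exact: measurable_seg.
- exact: measurable_seg.
by apply: lte_mul_pinfty; rewrite ?ge0_fin_numE ?seg_lty ?box2_lty.
Qed.

Lemma compact_sub_box3 (R : realType) (K : set (point3 R)) :
  compact K -> exists2 M : R, 0 < M & K `<=` box3 M.
Proof.
move=> /compact_bounded [N [_ KN]].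
have NM : N < `|N| + 1 by rewrite (le_lt_trans (ler_norm _))// ltrDl.
exists (`|N| + 1) => [|x Kx]; first by rewrite ltr_wpDl.
have /= := KN _ NM _ Kx; rewrite !prod_normE/= !ge_max => /andP[/andP[x1 x2] x3].
by split; [split|]; rewrite /seg/= in_itv/= -ler_norml.
Qed.

(** * Integrals of derivatives *)

Local Notation mu := lebesgue_measure.

Lemma integral_derive (R : realType) (F H : R -> R) (a b : R) :
  a < b -> (forall t : R, is_derive t 1 F (H t)) -> continuous H ->
  (\int[mu]_(t in `[a, b]) (H t)%:E = (F b - F a)%:E)%E.
Proof.
move=> ab dF cH; rewrite (@continuous_FTC2 _ H F)//.
- exact: continuous_subspaceT.
- have cF : continuous F.
    by move=> x; apply/differentiable_continuous/derivable1_diffP; case: (dF x).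
  by split; [move=> x _; case: (dF x)|exact/cvg_at_right_filter/cF|
     exact/cvg_at_left_filter/cF].
- by move=> x _; rewrite derive1E; apply: derive_val.
Qed.

Lemma integral_compact_derive_eq0 (R : realType) (F H : R -> R) (M : R) :
  (forall t : R, is_derive t 1 F (H t)) -> continuous H -> 0 < M ->
  (forall t, ~ seg M t -> F t = 0 /\ H t = 0) ->
  (\int[@lebesgue_measure R]_t (H t)%:E = 0)%E.
Proof.
move=> dF cH M0 FH0.
have segN t : ~~ (- M <= t <= M) -> ~ seg M t.
  by move=> /negP tM; rewrite /seg/= in_itv.
(* One unit of margin puts both end points outside the support. *)
have -> : (fun t => (H t)%:E) = (fun t => (H t)%:E) \_ [set` `[- (M + 1), M + 1]].
  apply/funext => t; rewrite patchE; case: ifPn => // /negP tM.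
  rewrite (FH0 t _).2//; apply: segN; apply: contra_notN tM => /andP[? ?].
  by rewrite inE/= in_itv/=; apply/andP; split; lra.
rewrite -integral_mkcond (integral_derive _ dF cH); last by lra.
by rewrite !(FH0 _ _).1 ?subrr//; apply: segN; apply/negP => /andP[]; lra.
Qed.

(** Both difference quotients are the same function of h.  This carries the
    one-variable calculus over to directional derivatives, and back. *)
Lemma is_derive_lineP (R : realType) (V : normedModType R) (g : V -> R)
    (c : R -> V) (v : V) (dg : R) (t : R) :
  (forall h, c (h + t) = h *: v + c t) ->
  is_derive (c t) v g dg <-> is_derive t 1 (g \o c) dg.
Proof.
move=> cE.
have E : (fun h : R => h^-1 *: (((g \o c) \o shift t) (h *: 1) - (g \o c) t)) =
         (fun h => h^-1 *: ((g \o shift (c t)) (h *: v) - g (c t))).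
  by apply/funext => h /=; rewrite -cE [h *: 1]mulr1.
split=> -[dvg <-].
  by split; [rewrite /derivable E|rewrite /derive E].
by split; [rewrite /derivable -E|rewrite /derive -E].
Qed.

Lemma notin_supp (R : realType) (V : normedModType R) (g : V -> R) (x : V) :
  ~ closure [set y | g y != 0] x -> g x = 0.
Proof.
by move=> xK; apply/eqP; apply: contra_notT xK => gx; exact: subset_closure.
Qed.

(** The complement of the closed support is open and g vanishes on it. *)
Lemma is_derive_supp (R : realType) (V : normedModType R) (g : V -> R)
    (x v : V) (dg : R) :
  ~ closure [set y | g y != 0] x -> is_derive x v g dg -> dg = 0.
Proof.
move=> xK [_ <-]; rewrite -(derive_cst (0 : R) v x); apply: near_eq_derive.
have : nbhs x (~` closure [set y | g y != 0]).
  by apply: open_nbhs_nbhs; split=> //; exact/closed_openC/closed_closure.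
apply: filterS => y yK; apply/eqP; apply: contra_notT yK => gy.
exact: subset_closure.
Qed.

Lemma continuous_compact_bounded (R : realType) (f : point3 R -> R)
    (K : set (point3 R)) :
  continuous f -> compact K -> exists C, forall x, K x -> `|f x| <= C.
Proof.
move=> cf cK.
have /compact_bounded[N [_ KN]] : compact (f @` K).
  by apply: continuous_compact => //; exact: continuous_subspaceT.
exists (`|N| + 1) => x Kx.
have NM : N < `|N| + 1 by rewrite (le_lt_trans (ler_norm _))// ltrDl.
by apply: (KN _ NM); exists x.
Qed.

Lemma continuous_integrable3 (R : realType) (f : point3 R -> R)
    (K : set (point3 R)) :
  continuous f -> compact K -> (forall x, ~ K x -> f x = 0) ->
  (leb3 R).-integrable setT (EFin \o f).
Proof.
move=> cf cK f0; have [M M0 KM] := compact_sub_box3 cK.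
have [C fC] := continuous_compact_bounded cf cK.
apply: (@integrable_bounded_supp _ _ _ _ (box3 M) (`|C|)).
- exact: measurable_box3.
- exact: box3_lty.
- exact: continuous_measurable3.
- move=> x; have [Kx|nKx] := pselect (K x).
    by rewrite (le_trans (fC _ Kx))// ler_norm.
  by rewrite f0// normr0.
- by move=> x xM; apply: f0; apply: contra_not xM; exact: KM.
Qed.

Lemma measurable_slice (R : realType) (f : point3 R -> R) (t : R) :
  continuous f ->
  measurable_fun setT (fun p : measurableTypeR R * measurableTypeR R => f (p, t)).
Proof.
move=> cf; apply: (measurableT_comp (continuous_measurable3 cf)).
by apply/measurable_fun_pair.
Qed.

(** A constant of its own, so that the product measure in the plane can carry the
    sigma-finite structure that Fubini's theorem needs on the first factor of
    leb3. *)
Definition leb2 (R : realType) :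
    set (measurableTypeR R * measurableTypeR R)%type -> \bar R :=
  (@lebesgue_measure R \x @lebesgue_measure R)%E.

Arguments leb2 R _ : clear implicits.
HB.instance Definition leb2_measure (R : realType) := Measure.on (leb2 R).

Lemma leb2_sigma_finite (R : realType) : sigma_finite setT (leb2 R).
Proof.
exists (fun n => @box2 R n%:R) => [|n]; last first.
  by split; [apply: measurableX; exact: measurable_seg|exact: box2_lty].
apply/esym/seteqP; split=> // -[/= x y] _.
have xyN := truncnS_gt (`|x : R| + `|y : R|); set N := _.+1 in xyN.
have [x0 y0] : 0 <= `|x : R| /\ 0 <= `|y : R| by [].
by exists N => //; split; rewrite /seg/= in_itv/= -ler_norml; lra.
Qed.

HB.instance Definition leb2_sigma_finite_measure (R : realType) :=
  Measure_isSigmaFinite.Build _ _ _ (leb2 R) (@leb2_sigma_finite R).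

Lemma integral3_fubini12 (R : realType) (f : mpoint3 R -> \bar R) :
  (leb3 R).-integrable setT f ->
  (\int[leb3 R]_x f x = \int[leb2 R]_p \int[@lebesgue_measure R]_t f (p, t))%E.
Proof.
by move=> fi; rewrite -(@integral12_prod_meas1 _ _ _ _ R (leb2 R) (@lebesgue_measure R) f fi).
Qed.

Lemma integral3_fubini21 (R : realType) (f : mpoint3 R -> \bar R) :
  (leb3 R).-integrable setT f ->
  (\int[leb3 R]_x f x = \int[@lebesgue_measure R]_t \int[leb2 R]_p f (p, t))%E.
Proof.
by move=> fi; rewrite -(@integral21_prod_meas1 _ _ _ _ R (leb2 R) (@lebesgue_measure R) f fi).
Qed.

Lemma integral3_lines2 (R : realType) (f : point3 R -> R) (K : set (point3 R)) :
  continuous f -> compact K -> (forall x, ~ K x -> f x = 0) ->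
  (forall x1 x2, \int[@lebesgue_measure R]_t (f (x1, x2, t))%:E = 0)%E ->
  (\int[leb3 R]_x (f x)%:E = 0)%E.
Proof.
move=> cf cK f0 line0.
have iF := continuous_integrable3 cf cK f0.
rewrite (integral3_fubini12 iF) /=; apply: integral0_eq => -[x1 x2] _.
exact: line0.
Qed.

(** The middle coordinate is reached by two applications of Fubini's theorem; a
    slice by a plane is integrable because it is itself bounded with bounded
    support. *)
Lemma integral3_lines1 (R : realType) (f : point3 R -> R) (K : set (point3 R)) :
  continuous f -> compact K -> (forall x, ~ K x -> f x = 0) ->
  (forall x1 x3, \int[@lebesgue_measure R]_t (f (x1, t, x3))%:E = 0)%E ->
  (\int[leb3 R]_x (f x)%:E = 0)%E.
Proof.
move=> cf cK f0 line0.
have iF := continuous_integrable3 cf cK f0.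
rewrite (integral3_fubini21 iF) /=; apply: integral0_eq => x3 _.
have [M M0 KM] := compact_sub_box3 cK.
have [C fC] := continuous_compact_bounded cf cK.
have iS : (leb2 R).-integrable setT
    (EFin \o (fun p : measurableTypeR R * measurableTypeR R => f (p, x3))).
  apply: (@integrable_bounded_supp _ _ _ _ (box2 M) `|C|).
  - by apply: measurableX; exact: measurable_seg.
  - exact: box2_lty.
  - exact: measurable_slice.
  - move=> p; have [Kx|nKx] := pselect (K (p, x3)).
      by rewrite (le_trans (fC _ Kx))// ler_norm.
    by rewrite f0// normr0.
  - by move=> p pM; apply: f0; apply: contra_not pM => /KM[].
rewrite -(integral12_prod_meas1 iS); apply: integral0_eq => x1 _.
exact: line0.
Qed.

Lemma continuous_pair (T U V : topologicalType) (f : T -> U) (g : T -> V) :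
  continuous f -> continuous g -> continuous (fun x => (f x, g x)).
Proof. by move=> cf cg x; exact: (cvg_pair (cf x) (cg x)). Qed.

Lemma continuousM3 (R : realType) (f g : point3 R -> R) :
  continuous f -> continuous g -> continuous (f \* g).
Proof. by move=> cf cg x; apply: cvgM; [exact: cf|exact: cg]. Qed.

(** The integrand is the derivative of f g in direction e_k, so it integrates to 0
    on each line parallel to e_k.  The direction e_1 is left out: fields that are
    constant in it only involve the other two. *)
Lemma integral_derive_mul_eq0 (R : realType) (k : 'I_3) (f f' g g' : point3 R -> R) :
  k != 0 ->
  (forall x, is_derive x (basis3 R k) f (f' x)) ->
  (forall x, is_derive x (basis3 R k) g (g' x)) ->
  continuous f -> continuous f' -> continuous g -> continuous g' ->
  support_in setT g ->
  (\int[leb3 R]_x (f x * g' x + g x * f' x)%:E = 0)%E.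
Proof.
move=> k0 df dg cf cf' cg cg' [cK _].
set K := closure _ in cK.
have g0 x : ~ K x -> g x = 0 by exact: notin_supp.
have g'0 x : ~ K x -> g' x = 0 by move=> Kx; exact: is_derive_supp Kx (dg x).
pose h x := f x * g' x + g x * f' x.
have ch : continuous h.
  by move=> x; apply: cvgD; exact: continuousM3.
have h0 x : ~ K x -> h x = 0.
  by move=> Kx; rewrite /h g0// g'0// mulr0 mul0r addr0.
have [M M0 KM] := compact_sub_box3 cK.
have dfg x : is_derive x (basis3 R k) (f * g) (h x).
  exact: is_derive_eq (is_deriveM (df x) (dg x)) _.
have line (c : R -> point3 R) :
    continuous c -> (forall t h, c (h + t) = h *: basis3 R k + c t) ->
    (forall t, ~ seg M t -> ~ box3 M (c t)) ->
    (\int[@lebesgue_measure R]_t (h (c t))%:E = 0)%E.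
  move=> cc cE cM.
  apply: (@integral_compact_derive_eq0 _ ((f * g) \o c) _ M) => //.
  - by move=> t; apply: (is_derive_lineP _ _ _).1 (dfg (c t)) => ?; exact: cE.
  - by move=> t; apply: continuous_comp; [exact: cc|exact: ch].
  - move=> t /cM tM; have tK : ~ K (c t) by apply: contra_not tM; exact: KM.
    by rewrite h0//= /GRing.mul/= g0// mulr0.
have [k1|k2] : k = 1 \/ k = 2%:R.
  by case: k k0 {df dg dfg line} => -[|[|[|//]]] // i _; [left|right]; exact: val_inj.
- apply: (integral3_lines1 ch cK h0) => x1 x3.
  apply: (line (fun t => (x1, t, x3))).
  + by apply: continuous_pair; [apply: continuous_pair|] => t;
      (exact: cvg_cst || exact: cvg_id).
  + by move=> t u; rewrite k1 /basis3/=; congr (_, _, _);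
      rewrite /= /GRing.scale/= ?mulr0 ?mulr1 ?add0r.
  + by move=> t tM [[]].
- apply: (integral3_lines2 ch cK h0) => x1 x2.
  apply: (line (fun t => (x1, x2, t))).
  + by apply: continuous_pair; [apply: continuous_pair|] => t;
      (exact: cvg_cst || exact: cvg_id).
  + by move=> t u; rewrite k2 /basis3/=; congr (_, _, _);
      rewrite /= /GRing.scale/= ?mulr0 ?mulr1 ?add0r.
  + by move=> t tM [[]].
Qed.

(** * The curl of an axial field *)

Definition real_field (R : realType) (v : point3 R -> 'rV[R]_3) : cfield3 R :=
  fun x => map_mx (real_complex R) (v x).

Definition axial (R : realType) (f : point3 R -> R) (x : point3 R) : 'rV[R]_3 :=
  f x *: delta_mx 0 0.

(** The curl of f e_1 when the derivatives of f along the second and third axes are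
    f1 and f2; indices count from 0. *)
Definition axial_curl (R : realType) (f1 f2 : point3 R -> R) (x : point3 R) :
    'rV[R]_3 :=
  f2 x *: delta_mx 0 1 - f1 x *: delta_mx 0 2%:R.

Lemma sum3E (R : realType) (a : 'I_3 -> R) : \sum_(k < 3) a k = a 0 + a 1 + a 2%:R.
Proof.
rewrite !big_ord_recr big_ord0 /= add0r.
by congr (a _ + a _ + a _); exact: val_inj.
Qed.

Lemma dotmul_real (R : realType) (v a : 'rV[R]_3) :
  dotmul (map_mx (real_complex R) v) a = (\sum_k v 0 k * a 0 k)%:C%C.
Proof.
by rewrite rmorph_sum; apply: eq_bigr => k _; rewrite mxE rmorphM.
Qed.

Lemma Rintegral_integral0 (R : realType) (f : point3 R -> R) :
  (\int[leb3 R]_x (f x)%:E = 0)%E -> \int[leb3 R]_x f x = 0.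
Proof. by rewrite /Rintegral => ->. Qed.

(** Only the components 1 and 2 of a test field meet the curl, each through one
    integration by parts. *)
Lemma is_curl_axial (R : realType) (f f1 f2 : point3 R -> R) :
  continuous f -> continuous f1 -> continuous f2 ->
  (forall x, is_derive x (basis3 R 1) f (f1 x)) ->
  (forall x, is_derive x (basis3 R 2%:R) f (f2 x)) ->
  is_curl setT (real_field (axial f)) (real_field (axial_curl f1 f2)).
Proof.
move=> cf cf1 cf2 df1 df2 phi tphi.
have c0 k : continuous (fun x => phi x 0 k) by have [/(_ [::])[]] := tphi k.
have c1 k j : continuous ('D_(basis3 R j) (fun x => phi x 0 k)).
  by have [/(_ [:: j])[]] := tphi k.
have d1 k j x :
    is_derive x (basis3 R j) (fun x => phi x 0 k) ('D_(basis3 R j) (fun x => phi x 0 k) x).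
  by have [/(_ [::])[_ dphi] _] := tphi k; exact/derivableP/dphi.
have s0 k : support_in setT (fun x => phi x 0 k) by have [] := tphi k.
have int_mul (a : point3 R -> R) k : continuous a ->
    (leb3 R).-integrable setT (EFin \o (fun x => a x * phi x 0 k)).
  move=> ca; apply: (continuous_integrable3 _ (s0 k).1); first exact: continuousM3.
  by move=> x /notin_supp ->; rewrite mulr0.
have int_mulD (a : point3 R -> R) k j : continuous a ->
    (leb3 R).-integrable setT
      (EFin \o (fun x => a x * 'D_(basis3 R j) (fun x => phi x 0 k) x)).
  move=> ca; apply: (continuous_integrable3 _ (s0 k).1); first exact: continuousM3.
  by move=> x Kx; rewrite (is_derive_supp Kx (d1 k j x)) mulr0.
have parts k j (a : point3 R -> R) : j != 0 -> continuous a ->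
    (forall x, is_derive x (basis3 R j) f (a x)) ->
    \int[leb3 R]_x (a x * phi x 0 k) =
    - \int[leb3 R]_x (f x * 'D_(basis3 R j) (fun x => phi x 0 k) x).
  move=> j0 ca da; apply/eqP; rewrite -addr_eq0 -RintegralD//; last 2 first.
    exact: int_mul.
    exact: int_mulD.
  apply/eqP/Rintegral_integral0.
  rewrite -[RHS](integral_derive_mul_eq0 j0 da (d1 k j) cf ca (c0 k) (c1 k j) (s0 k)).
  by apply: eq_integral => x _; congr EFin; rewrite addrC [a x * _]mulrC.
have e3 : (1 + 2%:R : 'I_3) = 0 by exact: val_inj.
congr Complex; last first.
  by apply: eq_Rintegral => x _; rewrite !dotmul_real.
transitivity (\int[leb3 R]_x (f2 x * phi x 0 1 - f1 x * phi x 0 2%:R)).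
  apply: eq_Rintegral => x _; rewrite dotmul_real sum3E /= !mxE/=.
  by ring.
transitivity (\int[leb3 R]_x
    (f x * 'D_(basis3 R 1) (fun y => phi y 0 2%:R) x -
     f x * 'D_(basis3 R 2%:R) (fun y => phi y 0 1) x)); last first.
  apply: eq_Rintegral => x _; rewrite dotmul_real sum3E /= !mxE/=.
  by rewrite !add0r !mulr0 !mul0r !addr0 mulr1 mulrBr.
rewrite !RintegralB//; try (by apply: int_mul); try (by apply: int_mulD).
by rewrite (parts 1 2%:R f2)// (parts 2%:R 1 f1)// opprK addrC.
Qed.

(** * A C^1 cut-off on the line *)

Definition ramp (R : realType) (t : R) : R := Num.max t 0.
(** The quadratic spline with knots 0, 1/2 and 1: its derivative is the hat function
    of height 2 on [0, 1], so it rises from 0 to 1 and is C^1. *)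
Definition cutoff (R : realType) (t : R) : R :=
  2 * (ramp t ^+ 2 - 2 * ramp (t - 2^-1) ^+ 2 + ramp (t - 1) ^+ 2).
Definition dcutoff (R : realType) (t : R) : R :=
  4 * (ramp t - 2 * ramp (t - 2^-1) + ramp (t - 1)).

Lemma continuous_ramp (R : realType) : continuous (@ramp R).
Proof. by move=> t; apply: continuous_max; [exact: cvg_id|exact: cvg_cst]. Qed.

Lemma rampP (R : realType) (t : R) :
  (0 <= t /\ ramp t = t) \/ (t <= 0 /\ ramp t = 0).
Proof.
by rewrite /ramp; case: (leP t 0) => t0; [right|left; split=> //; exact: ltW].
Qed.

(** At 0 the difference quotient is the ramp itself, which is continuous. *)
Lemma is_derive_ramp2 (R : realType) (t : R) :
  is_derive t 1 (fun s => ramp s ^+ 2) (2 * ramp t).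
Proof.
have [t0|t0|->] := ltgtP t 0.
- have -> : 2 * ramp t = 0 :> R by rewrite /ramp max_r ?mulr0// ltW.
  apply: (near_eq_is_derive _ (is_derive_cst (0 : R) t 1)).
  near=> s; rewrite /ramp max_r ?expr0n//= ltW//.
  by near: s; exact: lt_nbhsl.
- have -> : 2 * ramp t = t *+ 2 by rewrite /ramp max_l ?mulr_natl// ltW.
  have sq : is_derive t 1 (fun s : R => s ^+ 2) (t *+ 2).
    by apply: is_derive_eq; rewrite /GRing.scale/=; ring.
  apply: (near_eq_is_derive _ sq).
  near=> s; rewrite /ramp max_l// ltW//.
  by near: s; exact: lt_nbhsr.
- apply/is_derive1_caratheodory; exists (@ramp R); split=> [z||].
  + have [[_ ->]|[_ ->]] := rampP z; rewrite /ramp maxxx; ring.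
  + exact: continuous_ramp.
  + by rewrite /ramp maxxx mulr0.
Unshelve. all: by end_near. Qed.

Lemma is_derive_cutoff (R : realType) (t : R) :
  is_derive t 1 (@cutoff R) (dcutoff t).
Proof.
have dramp (c : R) : is_derive t 1 (fun s => ramp (s - c) ^+ 2) (2 * ramp (t - c)).
  have d := is_derive_ramp2 (t - c).
  have e : is_derive t 1 (fun s => s - c) 1 by apply: is_derive_eq; rewrite subr0.
  have := @is_derive1_comp _ (fun s => ramp s ^+ 2) (fun s => s - c) t _ _ d e.
  by rewrite mulr1.
rewrite /cutoff; have d0 := is_derive_ramp2 t; have d1 := dramp 2^-1; have d2 := dramp 1.
by apply: is_derive_eq; rewrite /GRing.scale/= /dcutoff; ring.
Qed.

Lemma continuous_dcutoff (R : realType) : continuous (@dcutoff R).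
Proof.
have cr (c : R) : continuous (fun t => ramp (t - c)).
  move=> t; apply: (@continuous_comp _ _ _ (fun s => s - c)); last exact: continuous_ramp.
  by apply: cvgB; [exact: cvg_id|exact: cvg_cst].
move=> t; apply: cvgM; first exact: cvg_cst.
apply: cvgD; last exact: cr.
apply: cvgB; first exact: continuous_ramp.
by apply: cvgM; [exact: cvg_cst|exact: cr].
Qed.

Lemma continuous_cutoff (R : realType) : continuous (@cutoff R).
Proof.
move=> t; apply/differentiable_continuous/derivable1_diffP.
by case: (is_derive_cutoff t).
Qed.

Lemma cutoff_le0 (R : realType) (t : R) : t <= 0 -> cutoff t = 0.
Proof.
by move=> t0; rewrite /cutoff /ramp !max_r ?expr0n/=; last (by lra); try lra; ring.
Qed.

Lemma cutoff_ge1 (R : realType) (t : R) : 1 <= t -> cutoff t = 1.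
Proof.
by move=> t1; rewrite /cutoff /ramp !max_l; try lra; field.
Qed.

Lemma dcutoff_ge1 (R : realType) (t : R) : 1 <= t -> dcutoff t = 0.
Proof.
by move=> t1; rewrite /dcutoff /ramp !max_l; try lra; field.
Qed.

Lemma dcutoff_bound (R : realType) (t : R) : 0 <= dcutoff t <= 2.
Proof.
rewrite /dcutoff.
have [[? ->]|[? ->]] := rampP t; have [[? ->]|[? ->]] := rampP (t - 2^-1);
have [[? ->]|[? ->]] := rampP (t - 1); apply/andP; split; lra.
Qed.

Lemma cutoff_bound (R : realType) (t : R) : 0 <= cutoff t <= 1.
Proof.
rewrite /cutoff.
have [[? ->]|[? ->]] := rampP t; have [[? ->]|[? ->]] := rampP (t - 2^-1);
have [[? ->]|[? ->]] := rampP (t - 1); apply/andP; split; nra.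
Qed.

(** * The logarithmic potential *)

Definition gauge (R : realType) (a b : R) (x : point3 R) : R :=
  sin (pi * (x.1.2 - a)) ^+ 2 + (pi * (x.2 - b)) ^+ 2.
(** The shift by d keeps the logarithm smooth where the gauge vanishes.  The scale
    runs from 0 at gauge d to 1 at gauge 2 d e^L - d. *)
Definition logscale (R : realType) (a b d L : R) (x : point3 R) : R :=
  (ln (gauge a b x + d) - ln (2 * d)) / L.
Definition profile (R : realType) (a b d L : R) (x : point3 R) : R :=
  cutoff (logscale a b d L x).
(** The derivatives of the profile along the second and third axes. *)
Definition profile1 (R : realType) (a b d L : R) (x : point3 R) : R :=
  dcutoff (logscale a b d L x) *
  (2 * pi * sin (pi * (x.1.2 - a)) * cos (pi * (x.1.2 - a))
     / (gauge a b x + d) / L).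
Definition profile2 (R : realType) (a b d L : R) (x : point3 R) : R :=
  dcutoff (logscale a b d L x) *
  (2 * pi ^+ 2 * (x.2 - b) / (gauge a b x + d) / L).

Lemma gauge_ge0 (R : realType) (a b : R) (x : point3 R) : 0 <= gauge a b x.
Proof. by rewrite addr_ge0 ?sqr_ge0. Qed.

(** Along a line parallel to an axis the profile is this function of one variable,
    with Q the gauge. *)
Lemma is_derive_logcut (R : realType) (Q : R -> R) (c d L dQ t : R) :
  0 < d -> 0 <= Q t -> is_derive t 1 Q dQ ->
  is_derive t 1 (fun s => cutoff ((ln (Q s + d) - c) / L))
    (dcutoff ((ln (Q t + d) - c) / L) * (dQ / (Q t + d) / L)).
Proof.
move=> d0 Q0 DQ.
have dQd : is_derive t 1 (fun s => Q s + d) dQ.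
  by apply: is_derive_eq; rewrite addr0.
have Qd0 : 0 < Q t + d by rewrite ltr_wpDl.
have dln := @is_derive1_comp _ (@ln R) _ t _ _ (is_derive1_ln Qd0) dQd.
have dth : is_derive t 1 (fun s => (ln (Q s + d) - c) / L) (dQ / (Q t + d) / L).
  have -> : (fun s => (ln (Q s + d) - c) / L) =
            (fun s => L^-1 *: (((@ln R) \o (fun s => Q s + d)) s - c)).
    by apply/funext => s; rewrite mulrC.
  by apply: is_derive_eq; rewrite subr0 /GRing.scale/=; ring.
exact: (@is_derive1_comp _ (@cutoff R) _ t _ _ (is_derive_cutoff _) dth).
Qed.

Lemma is_derive_profile1 (R : realType) (a b d L : R) (x : point3 R) :
  0 < d -> is_derive x (basis3 R 1) (profile a b d L) (profile1 a b d L x).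
Proof.
move=> d0; have -> : x = (x.1.1, x.1.2, x.2) by case: x => -[].
apply: (is_derive_lineP (c := fun s => (x.1.1, s, x.2)) _ _ _).2 => [h|].
  by rewrite /basis3/=; congr (_, _, _); rewrite /= /GRing.scale/= ?mulr0 ?mulr1 ?add0r.
apply: (is_derive_logcut _ _ d0) => /=; first exact: gauge_ge0.
have e : is_derive x.1.2 1 (fun s : R => pi * (s - a)) pi.
  by apply: is_derive_eq; rewrite subr0 /GRing.scale/= mulr1.
have es := @is_derive1_comp _ (@sin R) _ x.1.2 _ _ (is_derive_sin _) e.
have -> : (fun s => gauge a b (x.1.1, s, x.2)) =
   (fun s => ((@sin R) \o (fun s : R => pi * (s - a))) s ^+ 2 + (pi * (x.2 - b)) ^+ 2).
  by [].
by apply: is_derive_eq; rewrite /= addr0 /GRing.scale/=; ring.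
Qed.

Lemma is_derive_profile2 (R : realType) (a b d L : R) (x : point3 R) :
  0 < d -> is_derive x (basis3 R 2%:R) (profile a b d L) (profile2 a b d L x).
Proof.
move=> d0; have -> : x = (x.1.1, x.1.2, x.2) by case: x => -[].
apply: (is_derive_lineP (c := fun s => (x.1.1, x.1.2, s)) _ _ _).2 => [h|].
  by rewrite /basis3/=; congr (_, _, _); rewrite /= /GRing.scale/= ?mulr0 ?mulr1 ?add0r.
apply: (is_derive_logcut _ _ d0) => /=; first exact: gauge_ge0.
rewrite /gauge/=; apply: is_derive_eq; rewrite subr0 /GRing.scale/=; ring.
Qed.

Lemma continuous_x2 (R : realType) : continuous (fun x : point3 R => x.1.2).
Proof. by move=> x; apply: continuous_comp; [exact: cvg_fst|exact: cvg_snd]. Qed.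

Lemma continuous_x3 (R : realType) : continuous (fun x : point3 R => x.2).
Proof. by move=> x; exact: cvg_snd. Qed.

Lemma continuous_phase (R : realType) (a : R) :
  continuous (fun x : point3 R => pi * (x.1.2 - a)).
Proof.
move=> x; apply: cvgM; first exact: cvg_cst.
by apply: cvgB; [exact: continuous_x2|exact: cvg_cst].
Qed.

Lemma continuous_sin_phase (R : realType) (a : R) :
  continuous (fun x : point3 R => sin (pi * (x.1.2 - a))).
Proof.
move=> x; apply: (@continuous_comp _ _ _ (fun x : point3 R => pi * (x.1.2 - a)) (@sin R)).
  exact: continuous_phase.
exact: continuous_sin.
Qed.

Lemma continuous_cos_phase (R : realType) (a : R) :
  continuous (fun x : point3 R => cos (pi * (x.1.2 - a))).
Proof.
move=> x; apply: (@continuous_comp _ _ _ (fun x : point3 R => pi * (x.1.2 - a)) (@cos R)).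
  exact: continuous_phase.
exact: continuous_cos.
Qed.

Lemma continuous_gauge (R : realType) (a b : R) : continuous (gauge a b).
Proof.
move=> x; apply: cvgD; rewrite expr2; apply: cvgM; try exact: continuous_sin_phase.
all: by apply: cvgM; [exact: cvg_cst|apply: cvgB; [exact: continuous_x3|exact: cvg_cst]].
Qed.

Lemma continuous_gaugeD (R : realType) (a b d : R) :
  continuous (fun x => gauge a b x + d).
Proof. by move=> x; apply: cvgD; [exact: continuous_gauge|exact: cvg_cst]. Qed.

Lemma gaugeD_gt0 (R : realType) (a b d : R) (x : point3 R) :
  0 < d -> 0 < gauge a b x + d.
Proof. by move=> d0; rewrite ltr_wpDl// gauge_ge0. Qed.

Lemma continuous_logscale (R : realType) (a b d L : R) :
  0 < d -> continuous (logscale a b d L).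
Proof.
move=> d0 x; apply: cvgM; last exact: cvg_cst.
apply: cvgB; last exact: cvg_cst.
apply: (@continuous_comp _ _ _ (fun x => gauge a b x + d) (@ln R)).
  exact: continuous_gaugeD.
by apply: continuous_ln; exact: gaugeD_gt0.
Qed.

Lemma continuous_profile (R : realType) (a b d L : R) :
  0 < d -> continuous (profile a b d L).
Proof.
move=> d0 x; apply: (@continuous_comp _ _ _ (logscale a b d L) (@cutoff R)).
  exact: continuous_logscale.
exact: continuous_cutoff.
Qed.

Lemma continuous_slope (R : realType) (a b d L : R) (h : point3 R -> R) :
  0 < d -> continuous h ->
  continuous (fun x => dcutoff (logscale a b d L x) * (h x / (gauge a b x + d) / L)).
Proof.
move=> d0 ch x; apply: cvgM.
  apply: (@continuous_comp _ _ _ (logscale a b d L) (@dcutoff R)).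
    exact: continuous_logscale.
  exact: continuous_dcutoff.
apply: cvgM; last exact: cvg_cst.
apply: cvgM; first exact: ch.
apply: cvgV; last exact: continuous_gaugeD.
by rewrite gt_eqF// gaugeD_gt0.
Qed.

Lemma continuous_profile1 (R : realType) (a b d L : R) :
  0 < d -> continuous (profile1 a b d L).
Proof.
move=> d0; apply: continuous_slope => // x; apply: cvgM; last exact: continuous_cos_phase.
by apply: cvgM; [exact: cvg_cst|exact: continuous_sin_phase].
Qed.

Lemma continuous_profile2 (R : realType) (a b d L : R) :
  0 < d -> continuous (profile2 a b d L).
Proof.
move=> d0; apply: continuous_slope => // x; apply: cvgM; first exact: cvg_cst.
by apply: cvgB; [exact: continuous_x3|exact: cvg_cst].
Qed.

(** * Comparing the sine with the distance to its zeros *)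

Lemma sin_MVT (R : realType) (x : R) : 0 <= x ->
  exists2 c, 0 <= c <= x & sin x = cos c * x.
Proof.
move=> x0.
have [|c] := @MVT_segment R (@sin R) (@cos R) 0 x x0 (fun y _ => is_derive_sin y).
  by apply: continuous_subspaceT; exact: continuous_sin.
by rewrite in_itv/= sin0 !subr0; exists c.
Qed.

Lemma sqr_sin_le (R : realType) (x : R) : sin x ^+ 2 <= x ^+ 2.
Proof.
wlog x0 : x / 0 <= x => [h|].
  have [/h//|x0] := leP 0 x; have := h (- x); rewrite sinN !sqrrN.
  by apply; rewrite oppr_ge0 ltW.
by have [c _ ->] := sin_MVT x0; rewrite exprMn ler_piMl ?sqr_ge0.
Qed.

(** With y = x / 2, the mean value theorem and the monotonicity of cos give
    sin y >= y cos y, so sin x = 2 sin y cos y >= x (cos y)^2 = x (1 + cos x) / 2,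
    and cos x >= 0. *)
Lemma half_le_sin (R : realType) (x : R) : 0 <= x <= pi / 2 -> x / 2 <= sin x.
Proof.
move=> /andP[x0 xpi]; set y := x / 2.
have y0 : 0 <= y by rewrite /y; lra.
have ypi : y <= pi by have := pi_ge0 R; rewrite /y; lra.
have xE : x = y *+ 2 by rewrite /y; lra.
have [c /andP[c0 cy] sy] := sin_MVT y0.
have cyc : cos y <= cos c.
  by rewrite leNgt ltr_cos ?in_itv/= -?leNgt//; apply/andP; split; lra.
have cy0 : 0 <= cos y by apply: cos_ge0_pihalf; apply/andP; split; rewrite /y; lra.
have c2 : 1 <= cos y ^+ 2 *+ 2.
  by rewrite -subr_ge0 -cos_mulr2n -xE; apply: cos_ge0_pihalf; apply/andP; split; lra.
rewrite xE sin_mulr2n sy.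
have : cos y ^+ 2 <= cos y * cos c by rewrite expr2 ler_wpM2l.
nra.
Qed.

Lemma sqr_le_sin_pi (R : realType) (t : R) :
  - 2^-1 <= t <= 2^-1 -> t ^+ 2 <= sin (pi * t) ^+ 2.
Proof.
wlog t0 : t / 0 <= t => [h|].
  have [/h//|t0 /andP[t1 t2]] := leP 0 t.
  have := h (- t); rewrite mulrN sinN !sqrrN; apply; first by rewrite oppr_ge0 ltW.
  by apply/andP; split; lra.
move=> /andP[_ t2]; have p2 := pi_ge2 R; rewrite ler_sqr ?nnegrE//; last first.
  by apply: sin_ge0_pi; apply/andP; split; nra.
apply: (@le_trans _ _ (pi * t / 2)); first nra.
by apply: half_le_sin; apply/andP; split; nra.
Qed.

(** For x and a in the unit interval, x - a lies in [-1, 1] and its nearest integer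
    is -1, 0 or 1; the square of the sine is invariant under integer shifts. *)
Lemma sin_pi_zones (R : realType) (t : R) : -1 <= t <= 1 ->
  exists2 j : R, j \in [:: -1; 0; 1] & (t - j) ^+ 2 <= sin (pi * t) ^+ 2.
Proof.
move=> /andP[t1 t2].
have [tm|tm] := ltP t (- 2^-1).
  exists (-1); first by rewrite !inE eqxx.
  have -> : sin (pi * t) ^+ 2 = sin (pi * (t - -1)) ^+ 2.
    by rewrite opprK mulrDr mulr1 sinDpi sqrrN.
  by apply: sqr_le_sin_pi; apply/andP; split; lra.
have [tp|tp] := leP t 2^-1.
  exists 0; first by rewrite !inE eqxx orbT.
  by rewrite subr0; apply: sqr_le_sin_pi; apply/andP.
exists 1; first by rewrite !inE eqxx !orbT.
have -> : sin (pi * t) ^+ 2 = sin (pi * (t - 1)) ^+ 2.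
  by rewrite -[in LHS](subrK 1 t) mulrDr mulr1 sinDpi sqrrN.
by apply: sqr_le_sin_pi; apply/andP; split; lra.
Qed.

(** * Pointwise bounds on the potential *)

Lemma profile_bound (R : realType) (a b d L : R) (x : point3 R) :
  0 <= profile a b d L x <= 1.
Proof. exact: cutoff_bound. Qed.

Lemma profile_eq0 (R : realType) (a b d L : R) (x : point3 R) :
  0 < d -> 0 < L -> gauge a b x <= d -> profile a b d L x = 0.
Proof.
move=> d0 L0 xd; apply: cutoff_le0.
rewrite /logscale pmulr_lle0 ?invr_gt0// subr_le0 ler_ln ?posrE ?gaugeD_gt0//.
  by lra.
by rewrite mulr_gt0.
Qed.

Lemma logscale_ge1 (R : realType) (a b d L : R) (x : point3 R) :
  0 < d -> 0 < L -> 2 * d * expR L <= gauge a b x + d -> 1 <= logscale a b d L x.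
Proof.
move=> d0 L0 xd; rewrite /logscale ler_pdivlMr// mul1r lerBrDl.
rewrite -{1}(expRK L) -lnM ?posrE ?expR_gt0 ?mulr_gt0//.
by rewrite ler_ln ?posrE ?gaugeD_gt0// mulr_gt0 ?expR_gt0// mulr_gt0.
Qed.

(** The squares of the two derivatives of the gauge add up to at most 4 pi^2 q, and
    the cut-off has slope at most 2; one factor q + d cancels. *)
Lemma profile_grad_bound (R : realType) (a b d L : R) (x : point3 R) :
  0 < d -> 0 < L ->
  profile1 a b d L x ^+ 2 + profile2 a b d L x ^+ 2 <=
  16 * pi ^+ 2 / L ^+ 2 / (gauge a b x + d).
Proof.
move=> d0 L0; have qd := gaugeD_gt0 a b x d0.
rewrite /profile1 /profile2; set D := dcutoff _; set q := gauge a b x + d in qd *.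
set s := sin _; set c := cos _; set y := x.2 - b.
have -> : (D * (2 * pi * s * c / q / L)) ^+ 2 + (D * (2 * pi ^+ 2 * y / q / L)) ^+ 2 =
   4 * pi ^+ 2 / L ^+ 2 / q * (D ^+ 2 * ((s * c) ^+ 2 + (pi * y) ^+ 2) / q).
  by field; rewrite !gt_eqF.
have -> : 16 * pi ^+ 2 / L ^+ 2 / q = 4 * pi ^+ 2 / L ^+ 2 / q * (4 : R).
  by field; rewrite !gt_eqF.
apply: ler_wpM2l.
  apply: divr_ge0; last exact: ltW.
  by apply: divr_ge0; [apply: mulr_ge0 => //; exact: sqr_ge0|exact: sqr_ge0].
rewrite ler_pdivrMr//.
have D2 : D ^+ 2 <= 4.
  by have /andP[D0 D1] := dcutoff_bound (logscale a b d L x); rewrite -/D in D0 D1; nra.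
have c1 : c ^+ 2 <= 1.
  by rewrite -[leLHS](addrK (s ^+ 2)) cos2Dsin2 gerBl sqr_ge0.
apply: ler_pM; rewrite ?sqr_ge0 ?addr_ge0 ?sqr_ge0//.
apply: (@le_trans _ _ (gauge a b x)); last by rewrite /q; lra.
by rewrite /gauge lerD2r exprMn ler_piMr ?sqr_ge0.
Qed.

Lemma profile_grad_far (R : realType) (a b d L : R) (x : point3 R) :
  1 <= logscale a b d L x ->
  [/\ profile a b d L x = 1, profile1 a b d L x = 0 & profile2 a b d L x = 0].
Proof.
move=> x1; rewrite /profile /profile1 /profile2 dcutoff_ge1// !mul0r.
by rewrite cutoff_ge1.
Qed.

(** * The integral of the inverse gauge *)

Lemma atan_bound (R : realType) (x : R) : - (pi / 2) < atan x < pi / 2.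
Proof. by rewrite atan_gtNpi2 atan_ltpi2. Qed.

Lemma lorentz_rescale (R : realFieldType) (p A y : R) : 0 < p -> 0 < A ->
  (p * A)^-1 * ((1 + (p / A * y) ^+ 2)^-1 * (p / A)) = (A ^+ 2 + (p * y) ^+ 2)^-1.
Proof.
move=> p0 A0; have u0 : 0 < A ^+ 2 + (p * y) ^+ 2.
  by rewrite ltr_pwDl ?sqr_ge0// exprn_gt0.
by field; rewrite !gt_eqF//; move: u0; rewrite exprMn; lra.
Qed.

(** With A the square root of s + d, the integrand has the primitive
    atan (pi (t - b) / A) / (pi A), whose total variation on the line is 1 / A. *)
Lemma integral_lorentz_le (R : realType) (s b d : R) : 0 <= s -> 0 < d ->
  (\int[mu]_(t in `[(b - 2)%R, (b + 2)%R]) (s + (pi * (t - b)) ^+ 2 + d)^-1%:E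
    <= (Num.sqrt (s + d))^-1%:E)%E.
Proof.
move=> s0 d0; set A := Num.sqrt (s + d).
have A0 : 0 < A by rewrite sqrtr_gt0 ltr_wpDl.
have A2 : A ^+ 2 = s + d by rewrite sqr_sqrtr// ltW// ltr_wpDl.
have pi0 := pi_gt0 R.
pose F (t : R) : R := (pi * A)^-1 *: atan (pi / A * (t - b)).
have dF (t : R) : is_derive t 1 F (s + (pi * (t - b)) ^+ 2 + d)^-1.
  have e : is_derive t 1 (fun t : R => pi / A * (t - b)) (pi / A).
    by apply: is_derive_eq; rewrite subr0 /GRing.scale/= mulr1.
  have ea := @is_derive1_comp _ (@atan R) _ t _ _ (is_derive1_atan _) e.
  apply: (is_derive_eq (is_deriveZ (pi * A)^-1 ea)).
  by rewrite addrAC -A2 -(lorentz_rescale _ pi0 A0).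
have cH : continuous (fun t : R => (s + (pi * (t - b)) ^+ 2 + d)^-1).
  move=> t; apply: cvgV.
    by rewrite gt_eqF// ltr_wpDl// addr_ge0// sqr_ge0.
  apply: cvgD; last exact: cvg_cst.
  apply: cvgD; first exact: cvg_cst.
  rewrite expr2; apply: cvgM; (apply: cvgM; first exact: cvg_cst);
    by apply: cvgB; [exact: cvg_id|exact: cvg_cst].
rewrite (integral_derive _ dF cH); last by lra.
have -> : A^-1 = (pi * A)^-1 * pi by rewrite invfM mulrAC mulVf ?mul1r ?gt_eqF.
rewrite lee_fin /F /GRing.scale/= -mulrBr ler_wpM2l ?invr_ge0 ?mulr_ge0 ?ltW//.
have /andP[_ ?] := atan_bound (pi / A * (b + 2 - b)).
have /andP[? _] := atan_bound (pi / A * (b - 2 - b)).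
by lra.
Qed.

Lemma continuous_inv_sqrt (R : realType) (h : R -> R) :
  continuous h -> (forall x, 0 < h x) -> continuous (fun x => (Num.sqrt (h x))^-1).
Proof.
move=> ch h0 x; apply: cvgV; first by rewrite gt_eqF// sqrtr_gt0.
apply: (@continuous_comp _ _ _ h (@Num.sqrt R)); [exact: ch|exact: sqrt_continuous].
Qed.

Lemma continuous_inv_dist (R : realType) (c r : R) : 0 < r ->
  continuous (fun x : R => (Num.sqrt ((x - c) ^+ 2 + r ^+ 2))^-1).
Proof.
move=> r0; apply: continuous_inv_sqrt => x; last first.
  by rewrite ltr_wpDl ?sqr_ge0// exprn_gt0.
apply: cvgD; last exact: cvg_cst.
rewrite expr2; apply: cvgM; by apply: cvgB; [exact: cvg_id|exact: cvg_cst].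
Qed.

(** The integrand has the primitive ln (u + sqrt (u^2 + r^2)) with u = x - c.  Its
    argument is at most 5 at x = 1 and, being r^2 / (sqrt (u^2 + r^2) - u), at
    least r^2 / 5 at x = 0. *)
Lemma integral_inv_dist_le (R : realType) (c r : R) : -1 <= c <= 2 -> 0 < r < 1 ->
  (\int[mu]_(x in `[0%R, 1%R]) (Num.sqrt ((x - c) ^+ 2 + r ^+ 2))^-1%:E
    <= (2 * (ln 5 - ln r))%:E)%E.
Proof.
move=> /andP[c1 c2] /andP[r0 r1].
pose q (x : R) := Num.sqrt ((x - c) ^+ 2 + r ^+ 2).
have arg0 (x : R) : 0 < (x - c) ^+ 2 + r ^+ 2.
  by rewrite ltr_wpDl ?sqr_ge0// exprn_gt0.
have q0 x : 0 < q x by rewrite sqrtr_gt0.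
have q2 x : q x ^+ 2 = (x - c) ^+ 2 + r ^+ 2 by rewrite sqr_sqrtr// ltW.
have qc x : `|x - c| < q x.
  rewrite -(ltr_sqr (normr_ge0 _) (ltW (q0 x))) ?nnegrE// q2 real_normK ?num_real//.
  by rewrite ltrDl exprn_gt0.
have G0 x : 0 < x - c + q x.
  by have := qc x; rewrite ltr_norml => /andP[]; lra.
pose F (x : R) : R := ln (x - c + q x).
have dF (x : R) : is_derive x 1 F (q x)^-1.
  have e : is_derive x 1 (fun x => (x - c) ^+ 2 + r ^+ 2) (2 * (x - c)).
    by apply: is_derive_eq; rewrite /GRing.scale/=; ring.
  have es := @is_derive1_comp _ (@Num.sqrt R) _ x _ _ (is_derive1_sqrt (arg0 x)) e.
  have eg : is_derive x 1 (fun x => x - c + q x) ((x - c + q x) / q x).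
    have e1 : is_derive x 1 (fun x => x - c) 1.
      by apply: is_derive_eq; rewrite subr0.
    apply: (is_derive_eq (is_deriveD e1 es)).
    rewrite -/(q x); field; by rewrite gt_eqF.
  apply: (is_derive_eq (@is_derive1_comp _ (@ln R) _ x _ _ (is_derive1_ln (G0 x)) eg)).
  by rewrite mulrA mulVf ?mul1r// gt_eqF.
rewrite (integral_derive _ dF (@continuous_inv_dist R c r r0))// lee_fin /F.
have q5 x : 0 <= x <= 1 -> q x <= 3.
  move=> /andP[x0 x1].
  have : (x - c) ^+ 2 <= 4 by nra.
  have : r ^+ 2 <= 1 by nra.
  by have := q2 x; have := q0 x; nra.
have up : ln (1 - c + q 1) <= ln 5.
  by rewrite ler_ln ?posrE//; have := q5 1; rewrite ler01 lexx => /(_ isT); lra.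
have lo : ln (r ^+ 2 / 5) <= ln (0 - c + q 0).
  rewrite ler_ln ?posrE ?divr_gt0 ?exprn_gt0// ler_pdivrMr//.
  have := q2 0; have := q5 0; rewrite ler01 lexx => /(_ isT).
  by have := G0 0; have := q0 0; nra.
move: lo; rewrite ln_div ?posrE ?exprn_gt0// lnXn//.
by lra.
Qed.

Definition itv01 (R : realType) : set (measurableTypeR R) := [set` `[0%R, 1%R]].

Lemma continuous_phase1 (R : realType) (a d : R) : 0 < d ->
  continuous (fun x : R => (Num.sqrt (sin (pi * (x - a)) ^+ 2 + d))^-1).
Proof.
move=> d0; apply: continuous_inv_sqrt => x; last by rewrite ltr_wpDl ?sqr_ge0.
have cs : continuous (fun x : R => sin (pi * (x - a))).
  move=> y; apply: (@continuous_comp _ _ _ (fun x : R => pi * (x - a)) (@sin R)).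
    by apply: cvgM; [exact: cvg_cst|apply: cvgB; [exact: cvg_id|exact: cvg_cst]].
  exact: continuous_sin.
apply: cvgD; last exact: cvg_cst.
by rewrite expr2; apply: cvgM; exact: cs.
Qed.

(** The sine may vanish near one of a - 1, a and a + 1.  Adding the bounds for
    these three centres spares finding the nearest one. *)
Lemma integral_inv_sin_le (R : realType) (a r : R) : 0 < a < 1 -> 0 < r < 1 ->
  (\int[mu]_(x in `[0%R, 1%R])
     (Num.sqrt (sin (pi * (x - a)) ^+ 2 + (pi * r) ^+ 2))^-1%:E
    <= (6 * (ln 5 - ln r))%:E)%E.
Proof.
move=> /andP[a0 a1] /andP[r0 r1].
have pi2 := pi_ge2 R; have pi0 := pi_gt0 R.
pose k (c x : R) : R := (Num.sqrt ((x - c) ^+ 2 + r ^+ 2))^-1.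
have k0 c x : 0 <= k c x by rewrite invr_ge0 sqrtr_ge0.
have mk c : measurable_fun setT (EFin \o k c).
  apply/measurable_EFinP; apply: continuous_measurable_fun.
  exact: continuous_inv_dist.
have d0 : 0 < (pi * r) ^+ 2 by rewrite exprn_gt0// mulr_gt0.
apply: (@le_trans _ _ (\int[mu]_(x in `[0%R, 1%R])
    ((k (a - 1)%R x)%:E + (k a x)%:E + (k (a + 1)%R x)%:E))%E).
  apply: ge0_le_integral => //.
  - apply: measurable_funTS; apply/measurable_EFinP; apply: continuous_measurable_fun.
    exact: continuous_phase1.
  - by apply: measurable_funTS; do 2?apply: emeasurable_funD; exact: mk.
  move=> x; rewrite /= in_itv/= => /andP[x0 x1]; rewrite -!EFinD lee_fin.
  have [|j jin jle] := @sin_pi_zones R (x - a); first by apply/andP; split; lra.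
  have kj : (Num.sqrt (sin (pi * (x - a)) ^+ 2 + (pi * r) ^+ 2))^-1 <= k (a + j) x.
    have p1 : 0 < (x - (a + j)) ^+ 2 + r ^+ 2.
      by rewrite ltr_wpDl ?sqr_ge0// exprn_gt0.
    rewrite /k lef_pV2 ?posrE ?sqrtr_gt0//; last by rewrite ltr_wpDl ?sqr_ge0.
    apply: ler_wsqrtr; apply: lerD; first by rewrite opprD addrA.
    by rewrite exprMn ler_peMl ?sqr_ge0//; nra.
  apply: (le_trans kj).
  have := k0 (a - 1) x; have := k0 a x; have := k0 (a + 1) x.
  by move: jin; rewrite !inE => /or3P[] /eqP ->; rewrite ?addr0; lra.
have kI c x : (0 <= (k c x)%:E)%E by rewrite lee_fin.
rewrite ge0_integralD//; [|by move=> x _; rewrite adde_ge0|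
  by apply: emeasurable_funD; apply: measurable_funTS; exact: mk|
  by apply: measurable_funTS; exact: mk].
rewrite ge0_integralD//; [|by apply: measurable_funTS; exact: mk..].
have kle c : -1 <= c <= 2 ->
    (\int[mu]_(x in `[0%R, 1%R]) (k c x)%:E <= (2 * (ln 5 - ln r))%:E)%E.
  by move=> c12; apply: integral_inv_dist_le => //; apply/andP.
have -> : 6 * (ln 5 - ln r) =
    2 * (ln 5 - ln r) + 2 * (ln 5 - ln r) + 2 * (ln 5 - ln r) :> R by lra.
by rewrite !EFinD; apply: leeD; [apply: leeD|]; apply: kle; apply/andP; split; lra.
Qed.

Lemma itv01_measure (R : realType) : @lebesgue_measure R (@itv01 R) = 1%E.
Proof. by rewrite /itv01 lebesgue_measure_itv/= lte_fin ltr01 oppr0 adde0. Qed.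

(** Closed sides in x_1 and x_2 make it a product of segments; it contains every
    point of Z at which the potential differs from 1. *)
Definition slab (R : realType) (b : R) : set (mpoint3 R) :=
  (@itv01 R `*` @itv01 R) `*` [set` `[b - 2, b + 2]].

Lemma measurable_slab (R : realType) (b : R) : measurable (slab b).
Proof.
by apply: measurableX; [apply: measurableX|]; exact: measurable_itv.
Qed.

Lemma slab_lty (R : realType) (b : R) : (leb3 R (slab b) < +oo)%E.
Proof.
have mS := @measurable_slab R b.
apply: le_lt_trans (@box3_lty R (`|b| + 3)); apply: le_measure; rewrite ?inE//.
  exact: measurable_box3.
have := ler_norm b; have := ler_norm (- b); rewrite normrN => b1 b2.
move=> x [[]]; rewrite /itv01/= !in_itv/= => /andP[? ?] /andP[? ?] /andP[? ?].
by split; [split|]; rewrite /seg/= in_itv/=; apply/andP; split; lra.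
Qed.

(** Tonelli's theorem, integrating in x_3, then x_2, then x_1. *)
Lemma integral_inv_gauge_le (R : realType) (a b r : R) : 0 < a < 1 -> 0 < r < 1 ->
  (\int[leb3 R]_(x in slab b) (gauge a b x + (pi * r) ^+ 2)^-1%:E
    <= (6 * (ln 5 - ln r))%:E)%E.
Proof.
move=> a01 r01; have /andP[r0 r1] := r01; set d := (pi * r) ^+ 2.
have d0 : 0 < d by rewrite exprn_gt0// mulr_gt0// pi_gt0.
pose m : mpoint3 R -> \bar R := (fun x => (gauge a b x + d)^-1%:E) \_ (slab b).
have inv0 (x : point3 R) : 0 <= (gauge a b x + d)^-1.
  by rewrite invr_ge0 ltW// gaugeD_gt0.
have m0 x : (0 <= m x)%E by rewrite /m patchE; case: ifPn => //; rewrite lee_fin.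
have mm : measurable_fun setT m.
  apply: (measurable_restrictT _ (@measurable_slab R b)).1.
  apply: measurable_funTS; apply/measurable_EFinP; apply: continuous_measurable3.
  move=> x; apply: cvgV; last exact: continuous_gaugeD.
  by rewrite gt_eqF// gaugeD_gt0.
pose g (x : R) : R := (Num.sqrt (sin (pi * (x - a)) ^+ 2 + d))^-1.
have g0 x : 0 <= g x by rewrite invr_ge0 sqrtr_ge0.
pose G : measurableTypeR R * measurableTypeR R -> \bar R :=
  (fun p => (g p.2)%:E) \_ (@itv01 R `*` @itv01 R).
have G0 p : (0 <= G p)%E by rewrite /G patchE; case: ifPn => //; rewrite lee_fin.
have mg : measurable_fun setT (EFin \o g).
  apply/measurable_EFinP; apply: continuous_measurable_fun.
  exact: continuous_phase1.
have mG : measurable_fun setT G.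
  have mQ : measurable (@itv01 R `*` @itv01 R).
    by apply: measurableX; exact: measurable_itv.
  apply: (measurable_restrictT _ mQ).1.
  by apply: measurable_funTS; exact: (measurableT_comp mg measurable_snd).
rewrite integral_mkcond -/m.
have -> : (\int[leb3 R]_x m x = \int[leb2 R]_p \int[mu]_t m (p, t))%E.
  exact: (@fubini_tonelli1 _ _ _ _ R (leb2 R) mu m mm m0).
apply: (@le_trans _ _ (\int[leb2 R]_p G p)%E).
  apply: ge0_le_integral => //.
  - by move=> p _; apply: integral_ge0 => t _; exact: m0.
  - exact: (@measurable_fun_fubini_tonelli_F _ _ _ _ R mu m mm m0).
  move=> [x1 x2] _; rewrite /G patchE; case: ifPn => [xI|xI].
    apply: le_trans (integral_lorentz_le b (sqr_ge0 (sin (pi * (x2 - a)))) d0).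
    rewrite [leRHS]integral_mkcond le_eqVlt; apply/orP; left; apply/eqP.
    by apply: eq_integral => t _; rewrite /m !patchE in_setX xI.
  by rewrite integral0_eq// => t _; rewrite /m patchE in_setX (negbTE xI).
have -> : (\int[leb2 R]_p G p = \int[mu]_x1 \int[mu]_x2 G (x1, x2))%E.
  exact: (@fubini_tonelli1 _ _ _ _ R mu mu G mG G0).
apply: (@le_trans _ _ (\int[mu]_(x in @itv01 R) (6 * (ln 5 - ln r))%:E)%E).
  rewrite [leRHS]integral_mkcond; apply: ge0_le_integral => //.
  - by move=> x _; apply: integral_ge0 => t _; exact: G0.
  - exact: (@measurable_fun_fubini_tonelli_F _ _ _ _ R mu G mG G0).
  - have mI : measurable (@itv01 R) by exact: measurable_itv.
    exact: (measurable_restrictT _ mI).1 (measurable_cst _).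
  move=> x _; rewrite patchE; case: ifPn => xI.
    apply: le_trans (integral_inv_sin_le a01 r01).
    rewrite [leRHS]integral_mkcond le_eqVlt; apply/orP; left; apply/eqP.
    by apply: eq_integral => t _; rewrite /G !patchE in_setX xI.
  by rewrite integral0_eq// => t _; rewrite /G patchE in_setX (negbTE xI).
rewrite integral_cst; last exact: measurable_itv.
by rewrite [X in (_ * X)%E]itv01_measure mule1.
Qed.

(** * Square-integrable fields and restriction of the curl *)

Lemma Zset_box (R : realType) :
  @Zset R = (([set` `]0%R, 1%R[] `*` [set` `]0%R, 1%R[]) `*` setT : set (point3 R)).
Proof.
apply/seteqP; split=> x /=.
  by move=> [x1 x2]; rewrite /= !in_itv/=.
by move=> [[]]; rewrite /= !in_itv/= => ? ? _; split.
Qed.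

Lemma measurable_Zset (R : realType) : measurable (@Zset R : set (mpoint3 R)).
Proof.
rewrite Zset_box; apply: measurableX => //.
by apply: measurableX; exact: measurable_itv.
Qed.

Lemma vnorm_real_sqr (R : realType) (v : point3 R -> 'rV[R]_3) (x : point3 R) :
  vnorm (real_field v x) ^+ 2 = \sum_k v x 0 k ^+ 2.
Proof.
rewrite /vnorm sqr_sqrtr; last first.
  by apply: sumr_ge0 => k _; rewrite addr_ge0 ?sqr_ge0.
by apply: eq_bigr => k _; rewrite !mxE/= expr0n addr0.
Qed.

Lemma vnorm_axial (R : realType) (f : point3 R -> R) (x : point3 R) :
  vnorm (real_field (axial f) x) ^+ 2 = f x ^+ 2.
Proof. by rewrite vnorm_real_sqr sum3E !mxE/=; ring. Qed.

Lemma vnorm_axial_curl (R : realType) (f1 f2 : point3 R -> R) (x : point3 R) :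
  vnorm (real_field (axial_curl f1 f2) x) ^+ 2 = f1 x ^+ 2 + f2 x ^+ 2.
Proof. by rewrite vnorm_real_sqr sum3E !mxE/=; ring. Qed.

Lemma L2norm_le (R : realType) (D : set (point3 R)) (u : cfield3 R) (C : R) :
  0 <= C -> (\int[leb3 R]_(x in D) (vnorm (u x) ^+ 2)%:E <= C%:E)%E ->
  (L2norm D u <= (Num.sqrt C)%:E)%E.
Proof.
move=> C0 DC; rewrite /L2norm unlock.
have -> : (\int[leb3 R]_x `|((fun x => (vnorm (u x))%:E) \_ D) x| `^ 2 =
           \int[leb3 R]_(x in D) (vnorm (u x) ^+ 2)%:E)%E.
  rewrite [RHS]integral_mkcond; apply: eq_integral => x _; rewrite !patchE.
  case: ifPn => _; last by rewrite abse0 poweR0r.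
  by rewrite abse_EFin poweR_EFin powR_mulrn// real_normK ?num_real.
rewrite -powR12_sqrt// -poweR_EFin; apply: gt0_ler_poweR => //; rewrite ?in_itv/= ?leey ?andbT//.
by apply: integral_ge0 => x _; rewrite lee_fin sqr_ge0.
Qed.

Lemma compact_measurable3 (R : realType) (K : set (point3 R)) :
  compact K -> measurable (K : set (mpoint3 R)).
Proof.
move=> cK; rewrite -[K]setCK; apply: measurableC; apply: open_measurable3.
by apply: closed_openC; apply: compact_closed => //; exact: norm_hausdorff.
Qed.

Lemma L2loc_continuous (R : realType) (v : point3 R -> 'rV[R]_3) (Om : set (point3 R)) :
  (forall k, continuous (fun x => v x 0 k)) -> L2loc Om (real_field v).
Proof.
move=> cv; split=> [k|K cK _].
  split; apply: measurable_funTS; rewrite /real_field.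
    rewrite (_ : (fun x => _) = (fun x : mpoint3 R => v x 0 k)).
      exact: continuous_measurable3.
    by apply/funext => x; rewrite mxE.
  rewrite (_ : (fun x => _) = cst (0 : R)) ?measurable_cst//.
  by apply/funext => x; rewrite mxE.
pose n2 x := vnorm (real_field v x) ^+ 2.
have cn : continuous n2.
  have -> : n2 = fun x => v x 0 0 ^+ 2 + v x 0 1 ^+ 2 + v x 0 2%:R ^+ 2.
    by apply/funext => x; rewrite /n2 vnorm_real_sqr sum3E.
  by move=> x; apply: cvgD; [apply: cvgD|]; rewrite expr2; apply: cvgM; exact: cv.
have [C nC] := continuous_compact_bounded cn cK.
have [M M0 KM] := compact_sub_box3 cK.
have mK := compact_measurable3 cK.
have Kfin : (leb3 R K < +oo)%E.
  apply: le_lt_trans (@box3_lty R M); apply: le_measure; rewrite ?inE//.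
  exact: measurable_box3.
have C0 : 0 <= `|C| * fine (leb3 R K) by rewrite mulr_ge0// fine_ge0.
apply: le_lt_trans (ltry (Num.sqrt (`|C| * fine (leb3 R K)))).
apply: L2norm_le => //.
apply: (@le_trans _ _ (\int[leb3 R]_(x in K) `|C|%:E)%E).
  apply: ge0_le_integral => //.
  - by move=> x _; rewrite lee_fin sqr_ge0.
  - by apply: measurable_funTS; apply/measurable_EFinP; exact: continuous_measurable3.
  - move=> x Kx; rewrite lee_fin; have := nC x Kx.
    by rewrite ger0_norm ?sqr_ge0// => /le_trans; apply; exact: ler_norm.
by rewrite integral_cst// EFinM fineK// ge0_fin_numE.
Qed.

(** A test field on Om is a test field on the whole space that vanishes, together
    with its derivatives, off Om. *)
Lemma is_curl_restrict (R : realType) (Om : set (point3 R)) (u w : cfield3 R) :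
  is_curl setT u w -> is_curl Om u w.
Proof.
move=> uw phi tphi.
have tphiT : test_field setT phi by move=> k; have [sk [cK _]] := tphi k.
have phi0 x k : ~ Om x -> ~ closure [set y | phi y 0 k != 0] x.
  by move=> Omx; apply: contra_not Omx; have [_ [_]] := tphi k; exact.
have d0 x j k : ~ Om x -> 'D_(basis3 R j) (fun y => phi y 0 k) x = 0.
  move=> /(phi0 x k) /is_derive_supp; apply; apply/derivableP.
  by have [/(_ [::])[]] := tphi k.
have restr (g : point3 R -> R[i]) : (forall x, ~ Om x -> g x = 0) ->
    cintegral Om g = cintegral setT g.
  move=> g0; congr Complex; rewrite Rintegral_mkcond; apply: eq_Rintegral => x _;
    by rewrite patchE; case: ifPn => //; rewrite notin_setE => /g0 ->.
rewrite !restr; first exact: uw.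
- move=> x Omx; rewrite /dotmul big1// => k _.
  by rewrite !mxE !d0// subrr mulr0.
- move=> x Omx; rewrite /dotmul big1// => k _.
  by rewrite (notin_supp (phi0 x k Omx)) mulr0.
Qed.

(** * Periodicity and norms of the potential *)

Lemma add_basis3 (R : realType) (x : point3 R) (k : 'I_3) :
  x + basis3 R k =
  (x.1.1 + (k == 0)%:R, x.1.2 + (k == 1)%:R, x.2 + (k == 2%:R)%:R).
Proof. by case: x => -[]. Qed.

Lemma gauge_shift0 (R : realType) (a b : R) (x : point3 R) :
  gauge a b (x + basis3 R 0) = gauge a b x.
Proof. by rewrite add_basis3 /gauge/= !addr0. Qed.

(** A shift by one period changes the sign of the sine, which is squared. *)
Lemma gauge_shift1 (R : realType) (a b : R) (x : point3 R) :
  gauge a b (x + basis3 R 1) = gauge a b x.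
Proof.
rewrite add_basis3 /gauge/= addr0; congr (_ + _).
by rewrite addrAC mulrDr mulr1 sinDpi sqrrN.
Qed.

Lemma profile_gauge (R : realType) (a b d L : R) (x y : point3 R) :
  gauge a b x = gauge a b y -> profile a b d L x = profile a b d L y.
Proof. by move=> xy; rewrite /profile /logscale xy. Qed.

Lemma continuous_axial (R : realType) (f : point3 R -> R) (k : 'I_3) :
  continuous f -> continuous (fun x => axial f x 0 k).
Proof.
move=> cf; rewrite (_ : (fun x => _) = fun x => f x * (delta_mx 0 0 : 'rV[R]_3) 0 k).
  by move=> x; apply: cvgM; [exact: cf|exact: cvg_cst].
by apply/funext => x; rewrite mxE.
Qed.

Lemma continuous_axial_curl (R : realType) (f1 f2 : point3 R -> R) (k : 'I_3) :
  continuous f1 -> continuous f2 -> continuous (fun x => axial_curl f1 f2 x 0 k).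
Proof.
move=> cf1 cf2.
rewrite (_ : (fun x => _) = fun x => f2 x * (delta_mx 0 1 : 'rV[R]_3) 0 k -
                                     f1 x * (delta_mx 0 2%:R : 'rV[R]_3) 0 k).
  by move=> x; apply: cvgB; apply: cvgM; try exact: cvg_cst; [exact: cf2|exact: cf1].
by apply/funext => x; rewrite !mxE.
Qed.

Lemma axial_Hdot (R : realType) (f f1 f2 : point3 R -> R) :
  continuous f -> continuous f1 -> continuous f2 ->
  (forall x, is_derive x (basis3 R 1) f (f1 x)) ->
  (forall x, is_derive x (basis3 R 2%:R) f (f2 x)) ->
  (forall x, f (x + basis3 R 0) = f x) -> (forall x, f (x + basis3 R 1) = f x) ->
  Hdot_per_curl (real_field (axial f)).
Proof.
move=> cf cf1 cf2 df1 df2 p0 p1.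
exists (real_field (axial f)); split=> //.
- split; first by apply: L2loc_continuous => k; exact: continuous_axial.
  exists (real_field (axial_curl f1 f2)).
    by apply: L2loc_continuous => k; exact: continuous_axial_curl.
  exact: is_curl_axial.
- by apply: aeW => x; rewrite /real_field /axial p0.
- by apply: aeW => x; rewrite /real_field /axial p1.
Qed.

Lemma Zset_slab (R : realType) (b : R) (x : point3 R) :
  Zset x -> `|x.2 - b| <= 2 -> slab b x.
Proof.
move=> [/andP[x1 x1'] /andP[x2 x2']]; rewrite ler_norml => /andP[y1 y2].
by split; [split|]; rewrite /= /itv01/= in_itv/=; apply/andP; split; lra.
Qed.

Lemma scale_gt0 (R : realType) (r : R) : 0 < r < 1 ->
  0 < (pi * r) ^+ 2 /\ 0 < - ln r.
Proof.
move=> r01; have /andP[r0 _] := r01.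
by split; [rewrite exprn_gt0// mulr_gt0// pi_gt0|rewrite oppr_gt0 ln_lt0].
Qed.

(** Here 2 d e^L = 2 pi^2 r < (2 pi)^2, which the gauge exceeds. *)
Lemma far_logscale (R : realType) (a b r : R) (x : point3 R) :
  0 < r < 1 -> 2 < `|x.2 - b| -> 1 <= logscale a b ((pi * r) ^+ 2) (- ln r) x.
Proof.
move=> r01; have [d_gt0 L_gt0] := scale_gt0 r01; have /andP[r_gt0 r_lt1] := r01.
set d := (pi * r) ^+ 2 in d_gt0 *; set L := - ln r in L_gt0 *.
move=> far; apply: logscale_ge1 => //.
have -> : expR L = r^-1 by rewrite /L expRN lnK// posrE.
have -> : 2 * d / r = pi ^+ 2 * (2 * r) by rewrite /d; field; rewrite gt_eqF.
apply: (@le_trans _ _ (gauge a b x)); last by rewrite lerDl ltW.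
apply: (@le_trans _ _ ((pi * (x.2 - b)) ^+ 2)); last by rewrite lerDr sqr_ge0.
rewrite exprMn ler_wpM2l ?sqr_ge0//.
rewrite -(real_normK (num_real (x.2 - b))); nra.
Qed.

(** The choice of d comes from here: |sin y| <= |y| bounds the gauge by the square
    of pi times the distance to (a, b). *)
Lemma tube_gauge_le (R : realType) (a b r : R) (x : point3 R) :
  tube (a, b) r x -> gauge a b x <= (pi * r) ^+ 2.
Proof.
move=> [_]; rewrite /disc/= => /ltW xr; rewrite [leRHS]exprMn.
apply: (@le_trans _ _ ((pi * (x.1.2 - a)) ^+ 2 + (pi * (x.2 - b)) ^+ 2)).
  by rewrite lerD2r sqr_sin_le.
by rewrite !exprMn -mulrDr ler_wpM2l ?sqr_ge0.
Qed.

(** The bound does not depend on r: the integrand is at most 1 and vanishes off the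
    slab. *)
Lemma integral_profile_le (R : realType) (a b r : R) : 0 < r < 1 ->
  (\int[leb3 R]_(x in @Zset R)
     ((profile a b ((pi * r) ^+ 2) (- ln r) x - 1) ^+ 2)%:E <= leb3 R (slab b))%E.
Proof.
move=> r01; have [d_gt0 L_gt0] := scale_gt0 r01.
have far x := @far_logscale R a b r x r01.
set d := (pi * r) ^+ 2 in d_gt0 far *; set L := - ln r in L_gt0 far *.
have mS := @measurable_slab R b.
have cg : continuous (fun x => (profile a b d L x - 1) ^+ 2).
  have cp : continuous (fun x => profile a b d L x - 1).
    by move=> x; apply: cvgB; [exact: continuous_profile|exact: cvg_cst].
  by move=> x; exact: (cvgM (cp x) (cp x)).
rewrite -[leRHS]mul1e -integral_cst// [leLHS]integral_mkcond [leRHS]integral_mkcond.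
apply: ge0_le_integral => //.
- by move=> x _; rewrite patchE; case: ifPn => // _; rewrite lee_fin sqr_ge0.
- apply: (measurable_restrictT _ (@measurable_Zset R)).1; apply: measurable_funTS.
  by apply/measurable_EFinP; exact: continuous_measurable3.
- exact: (measurable_restrictT _ mS).1 (measurable_cst _).
move=> x _; rewrite !patchE; case: ifPn => [xZ|_]; last by case: ifPn.
have /andP[p0 p1] := profile_bound a b d L x.
case: ifPn => xS; first by rewrite lee_fin; nra.
have [xb|xb] := leP `|x.2 - b| 2.
  by move: xS; rewrite notin_setE => -[]; apply: Zset_slab => //; exact: set_mem.
by have [-> _ _] := profile_grad_far (far _ xb); rewrite subrr expr0n.
Qed.

Lemma integral_profile_grad_le (R : realType) (a b r : R) :
  0 < a < 1 -> 0 < r < 1 ->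
  (\int[leb3 R]_(x in @Zset R)
     (profile1 a b ((pi * r) ^+ 2) (- ln r) x ^+ 2 +
      profile2 a b ((pi * r) ^+ 2) (- ln r) x ^+ 2)%:E
   <= (16 * pi ^+ 2 / (- ln r) ^+ 2 * (6 * (ln 5 - ln r)))%:E)%E.
Proof.
move=> a01 r01; have [d_gt0 L_gt0] := scale_gt0 r01.
have far x := @far_logscale R a b r x r01.
have gauge_le := integral_inv_gauge_le b a01 r01.
set d := (pi * r) ^+ 2 in d_gt0 far gauge_le *; set L := - ln r in L_gt0 far gauge_le *.
have mS := @measurable_slab R b.
have K0 : 0 <= 16 * pi ^+ 2 / L ^+ 2 :> R.
  by apply: divr_ge0; [apply: mulr_ge0 => //|]; exact: sqr_ge0.
have inv0 (x : point3 R) : 0 <= (gauge a b x + d)^-1.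
  by rewrite invr_ge0 ltW// gaugeD_gt0.
have mg : measurable_fun setT (fun x : mpoint3 R => (gauge a b x + d)^-1%:E).
  apply/measurable_EFinP; apply: continuous_measurable3.
  move=> x; apply: cvgV; last exact: continuous_gaugeD.
  by rewrite gt_eqF// gaugeD_gt0.
apply: (@le_trans _ _ (\int[leb3 R]_(x in slab b)
    ((16 * pi ^+ 2 / L ^+ 2)%:E * (gauge a b x + d)^-1%:E))%E); last first.
  rewrite ge0_integralZl//; last 2 first.
  - exact: measurable_funTS.
  - by move=> x _; rewrite lee_fin.
  by rewrite [leRHS]EFinM; apply: lee_wpmul2l; rewrite ?lee_fin.
rewrite [leLHS]integral_mkcond [leRHS]integral_mkcond.
apply: ge0_le_integral => //.
- by move=> x _; rewrite patchE; case: ifPn => // _; rewrite lee_fin addr_ge0 ?sqr_ge0.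
- apply: (measurable_restrictT _ (@measurable_Zset R)).1; apply: measurable_funTS.
  apply/measurable_EFinP; apply: continuous_measurable3.
  move=> x; have c1 := @continuous_profile1 _ a b d L d_gt0 x.
  have c2 := @continuous_profile2 _ a b d L d_gt0 x.
  exact: (cvgD (cvgM c1 c1) (cvgM c2 c2)).
- apply: (measurable_restrictT _ mS).1; apply: measurable_funTS.
  exact: measurable_funeM.
move=> x _; rewrite !patchE; case: ifPn => [xZ|_]; last first.
  by case: ifPn => // _; rewrite lee_fin mulr_ge0.
case: ifPn => xS; first by rewrite lee_fin profile_grad_bound.
have [xb|xb] := leP `|x.2 - b| 2.
  by move: xS; rewrite notin_setE => -[]; apply: Zset_slab => //; exact: set_mem.
by have [_ -> ->] := profile_grad_far (far _ xb); rewrite expr0n addr0.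
Qed.

(** * Asymptotic disconnectedness *)

(** Otherwise the point (1, z0.2), which is not in the open square, would be in the
    disc: its distance to z0 is 1 - z0.1 < 1. *)
Lemma disc_radius_lt1 (R : realType) (z0 : R * R) (rho : R) :
  unit_square z0 -> closure (disc z0 rho) `<=` @unit_square R -> rho < 1.
Proof.
move=> [/andP[a0 a1] _] sub; rewrite ltNge; apply/negP => rho1.
have : disc z0 rho (1, z0.2) by rewrite /disc/= subrr; nra.
by move=> /subset_closure/sub[]; rewrite /= ltxx andbF.
Qed.

Lemma real_field_sub_cbasis (R : realType) (f : point3 R -> R) (x : point3 R) :
  real_field (axial f) x - cbasis3 R 0 = real_field (axial (fun y => f y - 1)) x.
Proof.
apply/rowP => k; rewrite !mxE/=; case: (k == 0); rewrite ?mulr1 ?mulr0.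
  by rewrite rmorphB rmorph1.
by rewrite subr0.
Qed.

Lemma squeeze_cvg0e (R : realType) (u : nat -> \bar R) (v : nat -> R) :
  (forall n, 0 <= u n)%E -> (forall n, u n <= (v n)%:E)%E ->
  v @ \oo --> (0 : R) -> u @ \oo --> 0%E.
Proof.
move=> u0 uv v0; apply: (@squeeze_cvge _ _ _ _ (cst 0%E) _ (EFin \o v)).
- by apply: nearW => n; rewrite u0 uv.
- exact: cvg_cst.
- by apply: cvg_EFin => //; exact: nearW.
Qed.

Lemma cvg_sqrt0 (R : realType) (v : nat -> R) :
  v @ \oo --> (0 : R) -> (fun n => Num.sqrt (v n)) @ \oo --> (0 : R).
Proof.
move=> v0; rewrite -[X in _ --> X](@sqrtr0 R).
by apply: (@cvg_comp _ _ _ v (@Num.sqrt R) _ _ _ v0); exact: sqrt_continuous.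
Qed.

Lemma energy_rate (R : realFieldType) (p c l0 l : R) :
  0 <= c -> 0 < l0 -> l0 <= l ->
  16 * p ^+ 2 / l ^+ 2 * (6 * (c + l)) <= 96 * p ^+ 2 * (c / l0 + 1) / l.
Proof.
move=> c0 l00 l0l; have l_gt0 : 0 < l by exact: lt_le_trans l0l.
have -> : 16 * p ^+ 2 / l ^+ 2 * (6 * (c + l)) = 96 * p ^+ 2 * (c / l + 1) / l.
  by field; rewrite gt_eqF.
have K0 : 0 <= 96 * p ^+ 2 by apply: mulr_ge0 => //; exact: sqr_ge0.
rewrite ler_wpM2r ?invr_ge0 ?(ltW l_gt0)// ler_wpM2l//.
by rewrite lerD2r ler_wpM2l// lef_pV2 ?posrE.
Qed.

Theorem proposition7p2 (R : realType) (z0 : R * R) (rho : R)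
    (eta r : nat -> R)
    (z0_in : unit_square z0)
    (rho_gt0 : 0 < rho)
    (disc_in : closure (disc z0 rho) `<=` @unit_square R)
    (eta_gt0 : forall n, 0 < eta n)
    (eta_to0 : eta @ \oo --> (0 : R))
    (r_bnd : forall n, 0 < r n <= rho ^+ 2)
    (eta_ln_r : (fun n => eta n * `|ln (r n)|) @ \oo --> +oo) :
  asymptotically_disconnected eta (fun n => tube z0 (r n)) 0.
Proof.
have rho1 := disc_radius_lt1 z0_in disc_in.
case: z0 z0_in disc_in => a b [/= a01 _] _.
have rho2 : 0 < rho ^+ 2 < 1 by apply/andP; split; nra.
have r01 n : 0 < r n < 1.
  have /andP[r0 r1] := r_bnd n; rewrite r0/=; case/andP: rho2; lra.
pose d n := (pi * r n) ^+ 2; pose L n := - ln (r n).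
have d0 n : 0 < d n by case: (scale_gt0 (r01 n)).
have L0 n : 0 < L n by case: (scale_gt0 (r01 n)).
pose f n := profile a b (d n) (L n).
pose f1 n := profile1 a b (d n) (L n).
pose f2 n := profile2 a b (d n) (L n).
have cf n : continuous (f n) by exact: continuous_profile.
have cf1 n : continuous (f1 n) by exact: continuous_profile1.
have cf2 n : continuous (f2 n) by exact: continuous_profile2.
have df1 n x : is_derive x (basis3 R 1) (f n) (f1 n x) by exact: is_derive_profile1.
have df2 n x : is_derive x (basis3 R 2%:R) (f n) (f2 n x) by exact: is_derive_profile2.
exists (fun n => real_field (axial (f n))), (fun n => real_field (axial_curl (f1 n) (f2 n))).
split.
- move=> n; apply: (axial_Hdot (cf n) (cf1 n) (cf2 n) (df1 n) (df2 n)) => x.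
    by apply: profile_gauge; exact: gauge_shift0.
  by apply: profile_gauge; exact: gauge_shift1.
- move=> n; split; first by apply: L2loc_continuous => k; exact: continuous_axial_curl.
  by apply: is_curl_restrict; exact: is_curl_axial.
- pose C := fine (leb3 R (slab b)).
  have Sfin := @slab_lty R b.
  have C0 : 0 <= C by exact: fine_ge0.
  apply: (@squeeze_cvg0e _ _ (fun n => Num.sqrt (eta n * C))).
  + by move=> n; rewrite mule_ge0 ?lee_fin ?sqrtr_ge0// /L2norm Lnorm_ge0.
  + move=> n; rewrite sqrtrM ?(ltW (eta_gt0 n))// EFinM.
    apply: lee_wpmul2l; first by rewrite lee_fin sqrtr_ge0.
    rewrite (_ : (fun x => _) = real_field (axial (fun x => f n x - 1))); last first.
      by apply/funext => x; exact: real_field_sub_cbasis.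
    apply: L2norm_le => //; rewrite fineK ?ge0_fin_numE//.
    under eq_integral do rewrite vnorm_axial.
    exact: integral_profile_le.
  + by apply: cvg_sqrt0; rewrite -[X in _ --> X](mul0r C); apply: cvgMl.
- move=> n; apply: aeW => x xT.
  have fx0 : f n x = 0 by apply: profile_eq0 => //; exact: tube_gauge_le xT.
  by apply/rowP => k; rewrite !mxE fx0 mul0r.
- pose L1 := - ln (rho ^+ 2).
  have L10 : 0 < L1 by rewrite oppr_gt0 ln_lt0.
  have LL1 n : L1 <= L n.
    rewrite lerN2 ler_ln ?posrE; first by case/andP: (r_bnd n).
      by case/andP: (r01 n).
    by case/andP: rho2.
  pose M := 96 * pi ^+ 2 * (ln 5 / L1 + 1) : R.
  have ln5 : 0 <= ln 5 :> R by rewrite ln_ge0// ler1n.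
  have pi96 : 0 <= 96 * pi ^+ 2 :> R by apply: mulr_ge0 => //; exact: sqr_ge0.
  have M0 : 0 <= M.
    apply: mulr_ge0 => //; apply: addr_ge0 => //; apply: divr_ge0 => //; exact: ltW.
  (* The bound is a constant times 1 / L because L stays above L1. *)
  have bound n : 16 * pi ^+ 2 / L n ^+ 2 * (6 * (ln 5 + L n)) <= M / L n.
    exact: energy_rate.
  apply: (@squeeze_cvg0e _ _ (fun n => Num.sqrt (M * (eta n * `|ln (r n)|)^-1))).
  + by move=> n; rewrite mule_ge0 ?lee_fin ?invr_ge0 ?sqrtr_ge0// /L2norm Lnorm_ge0.
  + move=> n; have -> : `|ln (r n)| = L n by rewrite ltr0_norm// ln_lt0.
    rewrite invfM mulrCA sqrtrM ?invr_ge0 ?(ltW (eta_gt0 n))// sqrtrV ?(ltW (eta_gt0 n))//.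
    rewrite EFinM; apply: lee_wpmul2l; first by rewrite lee_fin invr_ge0 sqrtr_ge0.
    apply: L2norm_le; first by rewrite divr_ge0// ltW.
    under eq_integral do rewrite vnorm_axial_curl.
    apply: le_trans (integral_profile_grad_le b a01 (r01 n)) _.
    by rewrite lee_fin; exact: bound.
  + apply: cvg_sqrt0; rewrite -[X in _ --> X](mulr0 M); apply: cvgMr.
    apply/gtr0_cvgV0 => //.
    by apply: nearW => n; rewrite mulr_gt0// normr_gt0 lt_eqF// ln_lt0.
Qed.
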